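(* Let $\Gamma=\mathbf{c}^{-1}(\mathrm{SO}_3(\mathbb{Z}[i]))\subset \mathrm{SL}_2(\mathbb{C})$, acting on $\mathbb{H}^3$ by fractional linear transformations. Let $\mathcal{G}\subset\mathbb{C}$ be the closed Euclidean triangle with vertices $1,\,2,\,1+i$. Then $$\mathcal{F}(\mathcal{G})=\mathscr{C}_{\mathbf H}\bigl(1+\sqrt2\,\mathbf{j},\;2+\mathbf{j},\;1+i+\mathbf{j},\;\infty\bigr),$$ the solid convex polytope in hyperbolic space with these four vertices, and it is a good Grenier fundamental domain for the action of $\Gamma$ on $\mathbb{H}^3$ (namely, the one associated to $\mathcal G$).
   Context: Upper half-space: $\mathbb{H}^3=\{x_1+x_2 i+y\mathbf{j}: x_1,x_2\in\mathbb{R},\ y>0\}$ inside the quaternions, with the hyperbolic metric $(dx_1^2+dx_2^2+dy^2)/y^2$; $\overline{\mathbb{H}^3}=\mathbb{H}^3\cup\mathbb{C}\cup\{\infty\}$. For $z=x_1+x_2i+y\mathbf j$ write $x(z)=x_1+x_2 i$, $y(z)=y$. $\mathrm{SL}_2(\mathbb{C})$ acts by $\gamma z=(az+b)(cz+d)^{-1}$ for $\gamma=\begin{pmatrix}a&b\\c&d\end{pmatrix}$. The group $\Gamma$: for $g\in \mathrm{SL}_2(\mathbb{C})$ let $\mathbf{c}(g)$ be the matrix of $X\mapsto gXg^{-1}$ on $\mathfrak{sl}_2(\mathbb{C})$ with respect to the basis $X_1=\begin{pmatrix}0&1\\1&0\end{pmatrix}$, $X_2=\begin{pmatrix}0&i\\-i&0\end{pmatrix}$,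 $Y=\begin{pmatrix}1&0\\0&-1\end{pmatrix}$, which is orthonormal for $B(X,Y)=\frac12\mathrm{Tr}(XY)$. Then $\mathbf{c}:\mathrm{SL}_2(\mathbb{C})\to \mathrm{SO}_3(\mathbb{C})$ is surjective with kernel $\{\pm I\}$, and $\Gamma$ is the preimage of the group $\mathrm{SO}_3(\mathbb{Z}[i])$ of matrices in $\mathrm{SO}_3(\mathbb{C})$ with entries in $\mathbb{Z}[i]$. Fundamental domain: if a group $\Delta$ acts on a topological space $X$, a subset $\mathcal F\subseteq X$ is a fundamental domain if $X=\Delta\mathcal F$ and for $\gamma_1\neq\gamma_2$ in $\Delta$ one has $\gamma_1\mathcal F\cap\gamma_2\mathcal F\subseteq \gamma_1\partial\mathcal F$ and $\subseteq\gamma_2\partial\mathcal F$. A ''fundamental domain for $\Gamma$'' means one for the quotient $\Gamma/\{\pm I\}$ (the quotient by the kernel of the action). Coordinates: $\phi=(\phi_1,\phi_2,\phi_3):\mathbb{H}^3\to\mathbb{R}^3$, $\phi_1=-\log y$, $\phi_2=x_1$, $\phi_3=x_2$; $\Gamma^{\phi_1}=\{\gamma\in\Gamma:\phi_1\circ\gamma=\phi_1\}$, $\Gamma^{\phi_{[1,2]}}=\{\gamma\in\Gamma:\phi_l\circ\gamma=\phi_l,\ l=1,2\}$. For $\gamma\in\Gamma$ put $\Delta_{1,\gamma}=\phi_1\circ\phi^{-1}-\phi_1\circ\gamma\circ\phi^{-1}:\mathbb{R}^3\to\mathbb{R}$. Axioms for a group acting on $\mathbb{H}^3$ by diffeomorphisms: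 (A1) for $\gamma\in\Gamma^{\phi_1}$, $\phi_2(\gamma z)$ does not depend on $\phi_1(z)$, and for $\gamma\in\Gamma^{\phi_{[1,2]}}$, $\phi_3(\gamma z)$ does not depend on $\phi_1(z),\phi_2(z)$; (A2) for $\gamma\in\Gamma-\Gamma^{\phi_1}$, no zero of $\Delta_{1,\gamma}$ is a critical point; (A3) for all $z\in\mathbb{H}^3$ and $B\in\mathbb{R}$ there is a neighborhood $U$ of $z$ such that $\phi_1(\gamma U)\cap(-\infty,B]\ne\emptyset$ for only finitely many cosets $\Gamma^{\phi_1}\gamma$; (A4) for each $z$ there is a direction $\mathbf u$ in $\mathbb{R}^3$, depending only on $z$, with $D_{\mathbf u}\Delta_{1,\gamma}(\phi(z))<0$ for all $\gamma\in\Gamma-\Gamma^{\phi_1}$. Good Grenier domain: suppose the action satisfies (A1)–(A4), and let $\mathcal{G}\subset\mathbb{R}^2=\mathbb{C}$ be a fundamental domain for the action of $\Gamma^{\phi_1}/\{\pm I\}$ on $\mathbb{C}$ induced through $x(\cdot)$, with $\mathcal G=\overline{\mathrm{Int}\,\mathcal G}$. Put $\mathcal F_1=\{z\in\mathbb{H}^3:\phi_1(z)\le\phi_1(\gamma z)\ \forall\gamma\in\Gamma\}$ and $\mathcal F(\mathcal G)=\{z\in\mathcal F_1: x(z)\in\mathcal G\}$. Then $\mathcal F(\mathcal G)$ is called the good Grenier fundamental domain for $\Gamma$ associated to $\mathcal G$. $\mathscr{C}_{\mathbf H}(p_1,\dots,p_r)$ denotes the smallest geodesically convex subset of $\overline{\mathbb{H}^3}$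 (hyperbolic metric) containing $p_1,\dots,p_r$; the ideal vertex $\infty$ is adjoined to $\mathcal F(\mathcal G)$ by convention, i.e. the equality is understood in $\mathbb{H}^3$ up to the point $\infty$. *)

(* Defs.v *)
From mathcomp Require Import all_boot all_order all_algebra.
From mathcomp Require Import complex ring lra.
From mathcomp Require Import all_classical all_reals all_analysis.

Set Implicit Arguments.
Unset Strict Implicit.
Unset Printing Implicit Defensive.

Import Order.TTheory GRing.Theory Num.Theory.
Import numFieldNormedType.Exports.

Local Open Scope classical_set_scope.
Local Open Scope ring_scope.
Local Open Scope complex_scope.

(** * Quaternions and the upper half-space *)

(* [Quat a b c d] is a + b i + c j + d k. *)
Record quat (R : Type) := Quat { q1 : R; qi : R; qj : R; qk : R }.

Definition qadd (R : realType) (p q : quat R) : quat R :=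
  Quat (q1 p + q1 q) (qi p + qi q) (qj p + qj q) (qk p + qk q).

Definition qmul (R : realType) (p q : quat R) : quat R :=
  Quat (q1 p * q1 q - qi p * qi q - qj p * qj q - qk p * qk q)
       (q1 p * qi q + qi p * q1 q + qj p * qk q - qk p * qj q)
       (q1 p * qj q - qi p * qk q + qj p * q1 q + qk p * qi q)
       (q1 p * qk q + qi p * qj q - qj p * qi q + qk p * q1 q).

Definition qinv (R : realType) (q : quat R) : quat R :=
  let n := q1 q ^+ 2 + qi q ^+ 2 + qj q ^+ 2 + qk q ^+ 2 in
  Quat (q1 q / n) (- qi q / n) (- qj q / n) (- qk q / n).

Definition qcplx (R : realType) (w : R[i]) : quat R :=
  let: a +i* b := w in Quat a b 0 0.

(* The point x1 + x2 i + y j is stored as the row vector (x1, x2, y). *)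
Definition row3 (R : realType) (a b c : R) : 'rV[R]_3 :=
  \row_(k < 3) nth 0 [:: a; b; c] k.

Definition x1 (R : realType) (z : 'rV[R]_3) : R := z 0 0.
Definition x2 (R : realType) (z : 'rV[R]_3) : R := z 0 1.
Definition ht (R : realType) (z : 'rV[R]_3) : R := z 0 2.

Definition H3 (R : realType) : set 'rV[R]_3 := [set z | 0 < ht z].

Definition xpart (R : realType) (z : 'rV[R]_3) : R * R := (x1 z, x2 z).

Definition quat_of (R : realType) (z : 'rV[R]_3) : quat R :=
  Quat (x1 z) (x2 z) (ht z) 0.

Definition qfrac (R : realType) (g : 'M[R[i]]_2) (z : 'rV[R]_3) : quat R :=
  qmul (qadd (qmul (qcplx (g 0 0)) (quat_of z)) (qcplx (g 0 1)))
       (qinv (qadd (qmul (qcplx (g 1 0)) (quat_of z)) (qcplx (g 1 1)))).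

(* Only the first three components of (a z + b)(c z + d)^-1 are kept: the
   k-component vanishes on H^3 when det g = 1, see [quat_of_mobius]. *)
Definition mobius (R : realType) (g : 'M[R[i]]_2) (z : 'rV[R]_3) : 'rV[R]_3 :=
  let q := qfrac g z in row3 (q1 q) (qi q) (qj q).

(** * The group Gamma *)

Definition sl2_basis (R : realType) (k : 'I_3) : 'M[R[i]]_2 :=
  nth 0
    [:: \matrix_(a < 2, b < 2) (a != b)%:R;
        \matrix_(a < 2, b < 2)
          (if (a == 0) && (b == 1) then 0 +i* 1
           else if (a == 1) && (b == 0) then - (0 +i* 1) else 0);
        \matrix_(a < 2, b < 2)
          (if a != b then 0 else if a == 0 then 1 else -1)] k.

(* M is the matrix c(g) of X |-> g X g^-1 in the basis X_1, X_2, Y; its j-th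
   column holds the coordinates of the image of the j-th basis vector. *)
Definition is_conj_matrix (R : realType) (g : 'M[R[i]]_2) (M : 'M[R[i]]_3) :=
  forall j : 'I_3,
    g *m sl2_basis R j *m invmx g = \sum_(k < 3) M k j *: sl2_basis R k.

Definition gaussian_int (R : realType) : set R[i] :=
  [set w | exists m n : int, w = m%:~R +i* n%:~R].

Definition SO3_Zi (R : realType) : set 'M[R[i]]_3 :=
  [set M | [/\ M^T *m M = 1%:M, \det M = 1 &
               forall k l, gaussian_int (M k l)]].

Definition SL2 (R : realType) : set 'M[R[i]]_2 := [set g | \det g = 1].

Definition Gamma (R : realType) : set 'M[R[i]]_2 :=
  [set g | SL2 g /\ exists2 M, is_conj_matrix g M & SO3_Zi M].

(** * Fundamental domains *)

(* The boundary of F as a subset of the space X (subspace topology). *)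
Definition boundary_in (T : topologicalType) (X F : set T) : set T :=
  closure (F : set (subspace X)) `\` interior (F : set (subspace X)).

(* The acting group is the quotient of [D] by the equivalence [eqD]; it acts on
   the subset [X] of [T] through [act]. *)
Definition fundamental_domain (T : topologicalType) (X : set T)
    (G : Type) (D : set G) (eqD : G -> G -> Prop) (act : G -> T -> T)
    (F : set T) : Prop :=
  [/\ F `<=` X,
      X = \bigcup_(g in D) (act g @` F) &
      forall g1 g2, D g1 -> D g2 -> ~ eqD g1 g2 ->
        (act g1 @` F) `&` (act g2 @` F) `<=` act g1 @` boundary_in X F /\
        (act g1 @` F) `&` (act g2 @` F) `<=` act g2 @` boundary_in X F].

(* Equality in the quotient by {I, -I}. *)
Definition eq_pm (R : realType) (g h : 'M[R[i]]_2) : Prop := g = h \/ g = - h.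

(** * Grenier domains *)

Definition phi1 (R : realType) (z : 'rV[R]_3) : R := - ln (ht z).
Definition phi2 (R : realType) (z : 'rV[R]_3) : R := x1 z.
Definition phi3 (R : realType) (z : 'rV[R]_3) : R := x2 z.

Definition phi (R : realType) (z : 'rV[R]_3) : 'rV[R]_3 :=
  row3 (phi1 z) (phi2 z) (phi3 z).

Definition phi_inv (R : realType) (p : 'rV[R]_3) : 'rV[R]_3 :=
  row3 (p 0 1) (p 0 2) (expR (- p 0 0)).

Definition stab1 (R : realType) (D : set 'M[R[i]]_2) : set 'M[R[i]]_2 :=
  [set g | D g /\ forall z, H3 z -> phi1 (mobius g z) = phi1 z].

Definition stab12 (R : realType) (D : set 'M[R[i]]_2) : set 'M[R[i]]_2 :=
  [set g | D g /\ forall z, H3 z ->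
     phi1 (mobius g z) = phi1 z /\ phi2 (mobius g z) = phi2 z].

Definition Delta1 (R : realType) (g : 'M[R[i]]_2) (p : 'rV[R]_3) : R :=
  phi1 (phi_inv p) - phi1 (mobius g (phi_inv p)).

Definition critical_point (R : realType) (f : 'rV[R]_3 -> R) (p : 'rV[R]_3) :=
  ~ differentiable f p \/ forall v, 'd f p v = 0.

Definition axiomA1 (R : realType) (D : set 'M[R[i]]_2) : Prop :=
  (forall g, stab1 D g -> forall z w : 'rV[R]_3, H3 z -> H3 w ->
     phi2 z = phi2 w -> phi3 z = phi3 w ->
     phi2 (mobius g z) = phi2 (mobius g w)) /\
  (forall g, stab12 D g -> forall z w : 'rV[R]_3, H3 z -> H3 w ->
     phi3 z = phi3 w ->
     phi3 (mobius g z) = phi3 (mobius g w)).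

Definition axiomA2 (R : realType) (D : set 'M[R[i]]_2) : Prop :=
  forall g, (D `\` stab1 D) g ->
  forall p : 'rV[R]_3, Delta1 g p = 0 -> ~ critical_point (Delta1 g) p.

Definition right_coset (R : realType) (S : set 'M[R[i]]_2) (g : 'M[R[i]]_2) :
    set 'M[R[i]]_2 :=
  [set h *m g | h in S].

Definition axiomA3 (R : realType) (D : set 'M[R[i]]_2) : Prop :=
  forall (z : 'rV[R]_3) (B : R), H3 z ->
  exists U : set 'rV[R]_3, [/\ nbhs z U, U `<=` @H3 R &
    finite_set [set right_coset (stab1 D) g | g in
      [set g | D g /\ exists2 w, U w & phi1 (mobius g w) <= B]]].

Definition axiomA4 (R : realType) (D : set 'M[R[i]]_2) : Prop :=
  forall z : 'rV[R]_3, H3 z ->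
  exists2 u : 'rV[R]_3, u != 0 &
    forall g, (D `\` stab1 D) g ->
      derivable (Delta1 g) (phi z) u /\ 'D_u (Delta1 g) (phi z) < 0.

(* The action on C induced through x(.): it is read off at height 1, the
   choice of height being immaterial for g in [stab1 D], see
   [xpart_mobius]. *)
Definition mobius_C (R : realType) (g : 'M[R[i]]_2) (w : R * R) : R * R :=
  xpart (mobius g (row3 w.1 w.2 1)).

Definition F1 (R : realType) (D : set 'M[R[i]]_2) : set 'rV[R]_3 :=
  [set z | H3 z /\ forall g, D g -> phi1 z <= phi1 (mobius g z)].

Definition grenier (R : realType) (D : set 'M[R[i]]_2) (G : set (R * R)) :
    set 'rV[R]_3 :=
  [set z | F1 D z /\ G (xpart z)].

Definition good_grenier_domain (R : realType) (D : set 'M[R[i]]_2)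
    (G : set (R * R)) (F : set 'rV[R]_3) : Prop :=
  [/\ [/\ axiomA1 D, axiomA2 D, axiomA3 D & axiomA4 D],
      fundamental_domain setT (stab1 D) (@eq_pm R) (@mobius_C R) G,
      G = closure (interior G) &
      F = grenier D G].

(** * Hyperbolic convexity *)

Definition hyp_metric (R : realType) (z : 'rV[R]_3) : 'M[R]_3 :=
  ((ht z ^+ 2)^-1)%:M.

Definition christoffel (R : realType) (m : 'rV[R]_3 -> 'M[R]_3)
    (z : 'rV[R]_3) (k i j : 'I_3) : R :=
  let dm (a b l : 'I_3) := 'D_(delta_mx 0 a) (fun w => m w b l) z in
  2^-1 * \sum_(l < 3) invmx (m z) k l * (dm i j l + dm j i l - dm l i j).

(* Complete (affinely parametrized) geodesics of H^3, as solutions of the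
   geodesic equation. *)
Definition geodesic_line (R : realType) (c : R -> 'rV[R]_3) : Prop :=
  forall t : R, H3 (c t) /\
  forall k : 'I_3,
    let ck (i : 'I_3) := fun s : R => c s 0 i in
    [/\ derivable (ck k) t 1, derivable (derive1 (ck k)) t 1 &
        derive1 (derive1 (ck k)) t +
        \sum_(i < 3) \sum_(j < 3)
          christoffel (@hyp_metric R) (c t) k i j * derive1 (ck i) t * derive1 (ck j) t
        = 0].

(* H^3 with its ideal points C and oo, inside the one-point compactification
   of R^3, [None] being the point oo. *)
Definition H3bar (R : realType) :
    set (one_point_compactification 'rV[R]_3) :=
  [set p | if p is Some z then 0 <= ht z else True].

(* p is the point, possibly ideal, of the line c at time a in [-oo, +oo]. *)
Definition point_at (R : realType) (c : R -> 'rV[R]_3) (a : \bar R)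
    (p : one_point_compactification 'rV[R]_3) : Prop :=
  let c' t : one_point_compactification 'rV[R]_3 := Some (c t) in
  match a with
  | r%:E => p = c' r
  | +oo%E => c' t @[t --> +oo_R] --> p
  | -oo%E => c' t @[t --> -oo_R] --> p
  end.

(* As H^3 is complete, every geodesic segment, ray or line is a piece of a
   [geodesic_line]. *)
Definition geodesically_convex (R : realType)
    (S : set (one_point_compactification 'rV[R]_3)) : Prop :=
  S `<=` @H3bar R /\
  forall (c : R -> 'rV[R]_3) (a b : \bar R) p q,
    geodesic_line c -> point_at c a p -> point_at c b q -> S p -> S q ->
    forall t : R, (a < t%:E)%E -> (t%:E < b)%E -> S (Some (c t)).

Definition hyp_hull (R : realType)
    (P : set (one_point_compactification 'rV[R]_3)) :
    set (one_point_compactification 'rV[R]_3) :=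
  smallest (@geodesically_convex R) P.

Definition triangle (R : realType) (u v w : R * R) : set (R * R) :=
  [set p | exists a b c : R,
     [/\ [/\ 0 <= a, 0 <= b & 0 <= c], a + b + c = 1 &
         p = a *: u + b *: v + c *: w]].

Lemma row3K (R : realType) (a b c : R) :
  [/\ x1 (row3 a b c) = a, x2 (row3 a b c) = b & ht (row3 a b c) = c].
Proof. by rewrite /x1 /x2 /ht !mxE. Qed.

Lemma row3E (R : realType) (z : 'rV[R]_3) : z = row3 (x1 z) (x2 z) (ht z).
Proof.
apply/rowP=> -[[|[|[|//]]] h]; rewrite !mxE /=; congr (z _ _); exact: val_inj.
Qed.

Lemma phiK (R : realType) (z : 'rV[R]_3) : H3 z -> phi_inv (phi z) = z.
Proof.
move=> z0; rewrite [RHS]row3E /phi_inv !mxE /= /phi1 opprK lnK //.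
Qed.

Lemma phi_invK (R : realType) (p : 'rV[R]_3) :
  H3 (phi_inv p) /\ phi (phi_inv p) = p.
Proof.
rewrite /H3 /= /phi /phi1 /phi2 /phi3.
have [-> -> ->] := row3K (p 0 1) (p 0 2) (expR (- p 0 0)).
by split; [exact: expR_gt0 | rewrite expRK opprK [RHS]row3E].
Qed.


Lemma det2E (K : comNzRingType) (g : 'M[K]_2) :
  \det g = g 0 0 * g 1 1 - g 0 1 * g 1 0.
Proof.
rewrite (expand_det_row _ 0) !big_ord_recl big_ord0 addr0 /cofactor !det_mx11.
rewrite !mxE /= expr0 expr1 mul1r mulN1r mulrN.
by congr (g _ _ * g _ _ - g _ _ * g _ _); apply: val_inj.
Qed.

Lemma quat_of_mobius (R : realType) (g : 'M[R[i]]_2) (z : 'rV[R]_3) :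
  SL2 g -> H3 z -> H3 (mobius g z) /\ quat_of (mobius g z) = qfrac g z.
Proof.
rewrite /SL2 /H3 /= det2E /mobius /quat_of.
set q := qfrac g z; have [-> -> ->] := row3K (q1 q) (qi q) (qj q).
rewrite /q /qfrac /quat_of.
move: (x1 z) (x2 z) (ht z) => x x' y {q}.
case: (g 0 0) (g 0 1) (g 1 0) (g 1 1) => [a a'] [b b'] [c c'] [d d'].
case=> /= D1 D2 y0.
rewrite /qmul /qadd /qinv /= !(mulr0, mul0r, subr0, addr0, add0r).
set N := _ ^+ 2 + _ + _ + _.
have N0 : 0 < N.
  rewrite lt_neqAle eq_sym !addr_ge0 ?sqr_ge0 // andbT.
  apply/eqP => /eqP; rewrite /N !paddr_eq0 ?addr_ge0 ?sqr_ge0 // !sqrf_eq0.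
  rewrite !mulf_eq0 (gt_eqF y0) !orbF => /andP[/andP[/andP[+ +] /eqP ec] /eqP ec'].
  move: D1; rewrite ec ec' !(mulr0, mul0r, oppr0, subr0, addr0, add0r).
  by move=> + /eqP d0 /eqP d'0; rewrite d0 d'0 !mulr0 subr0 => /esym/eqP;
    rewrite oner_eq0.
split.
  rewrite [ltRHS](_ : _ = y / N); first exact: divr_gt0.
  rewrite -[y in RHS]mulr1 -D1; ring.
congr Quat.
rewrite [RHS](_ : _ = y * (a * d' + a' * d - (b * c' + b' * c)) / N); last ring.
by rewrite D2 mulr0 mul0r.
Qed.

Lemma xpart_mobius (R : realType) (D : set 'M[R[i]]_2) (g : 'M[R[i]]_2)
    (z : 'rV[R]_3) :
  D `<=` @SL2 R -> stab1 D g -> H3 z ->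
  xpart (mobius g z) = mobius_C g (xpart z).
Proof.
move=> DSL [Dg g1] z0; have gSL := DSL _ Dg.
have htg w : H3 w -> ht (mobius g w) = ht w.
  move=> w0; have := g1 _ w0; rewrite /phi1 => /oppr_inj/ln_inj; apply.
    by have [] := quat_of_mobius gSL w0.
  exact: w0.
have cd w : H3 w -> qj (qfrac g w) = ht w.
  move=> w0; have [_ <-] := quat_of_mobius gSL w0; exact: htg.
have h1 : H3 (row3 0 0 1 : 'rV[R]_3).
  by rewrite /H3 /= /ht mxE.
have h2 : H3 (row3 0 0 2 : 'rV[R]_3).
  by rewrite /H3 /= /ht mxE /=.
have := cd _ h1; have := cd _ h2; move: gSL; rewrite /SL2 /= det2E.
rewrite /mobius_C /xpart /mobius.
set q := qfrac g z; have [-> -> _] := row3K (q1 q) (qi q) (qj q).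
set p := qfrac g (row3 (x1 z) _ _).
have [-> -> _] := row3K (q1 p) (qi p) (qj p).
rewrite /q /p /qfrac /quat_of.
have [-> -> ->] := row3K (0 : R) 0 1.
have [-> -> ->] := row3K (0 : R) 0 2.
have [-> -> ->] := row3K (x1 z) (x2 z) 1.
move: z0; rewrite /H3 /=.
move: (x1 z) (x2 z) (ht z) => x x' y {q p}.
case: (g 0 0) (g 0 1) (g 1 0) (g 1 1) => [a a'] [b b'] [c c'] [d d'].
move=> y0 [/= D1 D2].
rewrite /qmul /qadd /qinv /= !(mulr0, mul0r, subr0, addr0, add0r).
have hN (N t : R) : t != 0 ->
    (- 0 + b) * (- (c * t) / N) - b' * (- (c' * t) / N) + a * t * (d / N)
      + a' * t * (- d' / N) = t -> N = 1.
  move=> t0; rewrite [LHS](_ : _ =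
    t * ((a * d - a' * d' - (b * c - b' * c')) / N)); last ring.
  rewrite D1 mul1r -[RHS]mulr1 => /(mulfI t0)/eqP.
  by rewrite invr_eq1 => /eqP.
move=> /hN-/(_ (lt0r_neq0 (ltr0n _ 2))) N2 /hN-/(_ (oner_neq0 _)) N1.
have : c ^+ 2 + c' ^+ 2 = 0 by lra.
move/eqP; rewrite paddr_eq0 ?sqr_ge0 // !sqrf_eq0 => /andP[/eqP-> /eqP->].
by rewrite !(mulr0, mul0r, oppr0, subr0, addr0, add0r).
Qed.

(* Main.v *)
Require Import Defs.
From mathcomp Require Import all_boot all_order all_algebra.
From mathcomp Require Import complex ring lra zify.
From mathcomp Require Import all_classical all_reals all_analysis.

(* For g in Gamma with bottom row (c, d), the vectors (d^2 - c^2,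
   -i (d^2 + c^2), 2 c d) and c(g) have Gaussian integer entries, and pairing
   the former with the first row of c(g) gives 1.  Reducing modulo 1 + i, this
   forces c = 0, or |c|^2 = 1/2 with -d/c an odd Gaussian integer, or
   |c|^2 >= 1.  As y(g z) = y / (|c x + d|^2 + |c|^2 y^2), above the triangle
   the only constraint cutting out F_1 is the hemisphere |x - 1|^2 + y^2 = 2,
   while the elements with c = 0 act on C as the group generated by the rotation
   x |-> i x and the translations by (1 + i) Z[i].
   For convexity, a function (a (|x|^2 + y^2) + b x_1 + b' x_2 + d) / y is the
   restriction of a linear form of the hyperboloid model; along a geodesic of
   speed k it satisfies u'' = k^2 u, so it is A e^(kt) + B e^(-kt) and its sign
   between two points, ideal or not, is controlled by the end points. *)

Import Order.TTheory GRing.Theory Num.Theory.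
Import numFieldNormedType.Exports.

Local Open Scope classical_set_scope.
Local Open Scope ring_scope.

Set Implicit Arguments.
Unset Strict Implicit.
Unset Printing Implicit Defensive.

(** * Derivatives of real functions *)

(** The vector attached to the bottom row is the first row of c(g) minus i times the second. As c(g)
    is orthogonal, this vector is isotropic and pairs to 1 with the first row; these two relations
    between Gaussian integers carry the arithmetic. The integer |2 c^2|^2 is a sum of two squares,
    hence 0, 1, 2 or at least 4, and the point is to exclude 2. The entries of g need not lie in
    Q(i); only quadratic expressions in them are integral. Finiteness statements therefore go
    through 2 c^2 and 2 d^2, which determine c and d up to sign. On C the translation lattice has
    index 2 in Z[i] and the rotations have order 4, so the covolume is 2/4 = 1/2, the area of the
    triangle. Geodesics are given by an equation and their ends by limits in a compactification.
    They are never classified: the linear forms do that work when the solid is shown to be convex.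
    That the hull fills the solid needs only two explicit families, half-circles on the hemisphere,
    which sweep out the floor from its three vertices, and vertical lines, which fill the space
    above it. *)

Section RealDerivatives.
Variable R : realType.
Implicit Types (f g : R -> R) (x a b : R).

(** The rules below produce derivatives of explicit lambda terms in raw form; this lemma leaves the
    comparison with the expected value to [ring] or [field]. *)
Lemma is_der_eq f x a b : is_derive x 1 f a -> a = b -> is_derive x 1 f b.
Proof. by move=> h <-. Qed.

Lemma is_der_cst a x : is_derive x 1 (fun=> a) 0.
Proof. exact: is_derive_cst. Qed.

Lemma is_der_id x : is_derive x 1 (fun t => t) 1.
Proof. exact: is_derive_id. Qed.

Lemma is_derD f g x a b : is_derive x 1 f a -> is_derive x 1 g b ->
  is_derive x 1 (fun t => f t + g t) (a + b).
Proof. exact: is_deriveD. Qed.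

Lemma is_derN f x a : is_derive x 1 f a -> is_derive x 1 (fun t => - f t) (- a).
Proof. exact: is_deriveN. Qed.

Lemma is_derB f g x a b : is_derive x 1 f a -> is_derive x 1 g b ->
  is_derive x 1 (fun t => f t - g t) (a - b).
Proof. exact: is_deriveB. Qed.

Lemma is_derM f g x a b : is_derive x 1 f a -> is_derive x 1 g b ->
  is_derive x 1 (fun t => f t * g t) (f x * b + g x * a).
Proof. exact: is_deriveM. Qed.

Lemma is_derV f x a : f x != 0 -> is_derive x 1 f a ->
  is_derive x 1 (fun t => (f t)^-1) (- (f x) ^- 2 * a).
Proof. exact: is_deriveV. Qed.

Lemma is_der_exp f x a : is_derive x 1 f a ->
  is_derive x 1 (fun t => expR (f t)) (expR (f x) * a).
Proof. by move=> h; exact: (is_derive1_comp (is_derive_expR (f x)) h). Qed.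

Lemma is_der_ln f x a : 0 < f x -> is_derive x 1 f a ->
  is_derive x 1 (fun t => ln (f t)) ((f x)^-1 * a).
Proof. by move=> f0 h; exact: (is_derive1_comp (is_derive1_ln f0) h). Qed.

End RealDerivatives.

Lemma derive_line (R : realType) (V : normedModType R) (f : V -> R) (p v : V) :
  'D_v f p = 'D_1 (fun h : R => f (h *: v + p)) 0.
Proof.
rewrite /derive [X in lim (X @ _)](_ : _ = fun h : R =>
    h^-1 *: (((fun h : R => f (h *: v + p)) \o shift 0) (h *: 1) - f (0 *: v + p))) //.
by apply/funext => h /=; rewrite [h *: 1]mulr1 addr0 scale0r add0r.
Qed.

(** * Vectors and matrices of size 2 and 3 *)

Lemma ord2P (P : 'I_2 -> Prop) : P 0 -> P 1 -> forall i, P i.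
Proof.
move=> P0 P1 -[[|[|//]] h].
- by rewrite (_ : Ordinal h = 0) //; apply: val_inj.
- by rewrite (_ : Ordinal h = 1) //; apply: val_inj.
Qed.

Lemma ord3P (P : 'I_3 -> Prop) : P 0 -> P 1 -> P 2 -> forall i, P i.
Proof.
move=> P0 P1 P2 -[[|[|[|//]]] h].
- by rewrite (_ : Ordinal h = 0) //; apply: val_inj.
- by rewrite (_ : Ordinal h = 1) //; apply: val_inj.
- by rewrite (_ : Ordinal h = 2) //; apply: val_inj.
Qed.

Lemma sum2E (V : nmodType) (F : 'I_2 -> V) : \sum_(i < 2) F i = F 0 + F 1.
Proof.
rewrite !big_ord_recl big_ord0 addr0.
by congr (F _ + F _); apply: val_inj.
Qed.

Lemma sum3E (V : nmodType) (F : 'I_3 -> V) :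
  \sum_(i < 3) F i = F 0 + F 1 + F 2.
Proof.
rewrite !big_ord_recl big_ord0 addr0 addrA.
by congr (F _ + F _ + F _); apply: val_inj.
Qed.

Lemma matrix2P (K : Type) (A B : 'M[K]_2) :
  A 0 0 = B 0 0 -> A 0 1 = B 0 1 -> A 1 0 = B 1 0 -> A 1 1 = B 1 1 -> A = B.
Proof.
move=> h00 h01 h10 h11; apply/matrixP; apply: ord2P; exact: ord2P.
Qed.

Lemma mul2E (K : pzRingType) (A B : 'M[K]_2) i j :
  (A *m B) i j = A i 0 * B 0 j + A i 1 * B 1 j.
Proof. by rewrite mxE sum2E. Qed.

Definition mx2 (K : Type) (a b c d : K) : 'M[K]_2 :=
  \matrix_(i < 2, j < 2)
    (if i == 0 then if j == 0 then a else b else if j == 0 then c else d).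

Lemma mx2E (K : Type) (a b c d : K) :
  ((mx2 a b c d 0 0 = a) * (mx2 a b c d 0 1 = b) *
   (mx2 a b c d 1 0 = c) * (mx2 a b c d 1 1 = d))%type.
Proof. by rewrite /mx2 !mxE. Qed.

Lemma row3_inj (R : realType) (z w : 'rV[R]_3) :
  x1 z = x1 w -> x2 z = x2 w -> ht z = ht w -> z = w.
Proof. by move=> h1 h2 h3; rewrite (row3E z) (row3E w) h1 h2 h3. Qed.

Lemma invmx2 (K : comUnitRingType) (g : 'M[K]_2) : \det g = 1 ->
  invmx g = mx2 (g 1 1) (- g 0 1) (- g 1 0) (g 0 0).
Proof.
rewrite det2E => /(canRL (subrK _)) D.
set B := mx2 _ _ _ _.
have gB : g *m B = 1%:M.
  apply: matrix2P; rewrite mul2E !mx2E !mxE ?mulr1n ?mulr0n.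
  - by ring: D.
  - by ring.
  - by ring.
  - by ring: D.
have [ug _] := mulmx1_unit gB.
by rewrite -[RHS](mulKmx ug) gB mulmx1.
Qed.

Local Open Scope complex_scope.
Local Notation re := complex.Re.
Local Notation im := complex.Im.
Local Notation ci := (Complex 0 1).

(** * The action on the half-space *)

Definition nsq (R : realType) (w : R[i]) : R := re w ^+ 2 + im w ^+ 2.

Definition zx (R : realType) (z : 'rV[R]_3) : R[i] := x1 z +i* x2 z.

(* The factor in y(g z) = y(z) / jac g z. *)
Definition jac (R : realType) (g : 'M[R[i]]_2) (z : 'rV[R]_3) : R :=
  nsq (g 1 0 * zx z + g 1 1) + nsq (g 1 0) * ht z ^+ 2.

(* SL_2(C) acts on these matrices by H |-> g H g^*, which makes the
   multiplicativity of [mobius] evident. *)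
Definition herm (R : realType) (z : 'rV[R]_3) : 'M[R[i]]_2 :=
  mx2 ((nsq (zx z) + ht z ^+ 2) / ht z)%:C (zx z / (ht z)%:C)
      (conjc (zx z) / (ht z)%:C) (ht z)^-1%:C.

Lemma nsq_ge0 (R : realType) (w : R[i]) : 0 <= nsq w.
Proof. by rewrite addr_ge0 ?sqr_ge0. Qed.

Lemma nsq_eq0 (R : realType) (w : R[i]) : (nsq w == 0) = (w == 0).
Proof. by rewrite /nsq paddr_eq0 ?sqr_ge0 // !sqrf_eq0 eq_complex. Qed.

Lemma nsqM (R : realType) (v w : R[i]) : nsq (v * w) = nsq v * nsq w.
Proof. by case: v w => [a b] [c d]; rewrite /nsq /=; ring. Qed.

Lemma nsqE (R : realType) (w : R[i]) : (nsq w)%:C = w * conjc w.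
Proof. by case: w => a b; rewrite /nsq /=; apply/eqP; rewrite eq_complex /=; apply/andP; split; apply/eqP; ring. Qed.

Lemma jac_gt0 (R : realType) (g : 'M[R[i]]_2) (z : 'rV[R]_3) :
  SL2 g -> H3 z -> 0 < jac g z.
Proof.
rewrite /SL2 /H3 /= det2E /jac => D z0.
have nsq_gt0 (w : R[i]) : w != 0 -> 0 < nsq w.
  by rewrite -nsq_eq0 lt_neqAle nsq_ge0 eq_sym andbT.
have [c0|c0] := eqVneq (g 1 0) 0; last first.
  by apply: ltr_wpDl; [exact: nsq_ge0 | rewrite mulr_gt0 ?exprn_gt0 ?nsq_gt0].
apply: ltr_pwDl; last by rewrite mulr_ge0 ?nsq_ge0 ?sqr_ge0.
apply: nsq_gt0; apply/eqP => d0; move: D; move: d0; rewrite c0 mul0r add0r => ->.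
by rewrite !mulr0 subr0 => /esym/eqP; rewrite oner_eq0.
Qed.

(** The denominator [jac g z] is the quaternion norm of c z + d, brought in by the inverse; a d - b
    c = 1 then simplifies the height. *)
Lemma mobiusE (R : realType) (g : 'M[R[i]]_2) (z : 'rV[R]_3) :
  SL2 g ->
  zx (mobius g z) =
    ((g 0 0 * zx z + g 0 1) * conjc (g 1 0 * zx z + g 1 1) +
      g 0 0 * conjc (g 1 0) * (ht z ^+ 2)%:C) * (jac g z)^-1%:C /\
  ht (mobius g z) = ht z / jac g z.
Proof.
rewrite /SL2 /= det2E /mobius /jac.
set q := qfrac g z; rewrite {1}/zx; have [-> -> ->] := row3K (q1 q) (qi q) (qj q).
rewrite /q /qfrac /quat_of /zx {q}.
move: (x1 z) (x2 z) (ht z) => x x' y.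
case: (g 0 0) (g 0 1) (g 1 0) (g 1 1) => [a a'] [b b'] [c c'] [d d'].
case=> /= D1 D2.
rewrite /qmul /qadd /qinv /nsq /= !(mulr0, mul0r, subr0, addr0, add0r).
set N := _ ^+ 2 + _ + _ + _; set M := _ + _ * _ ^+ 2.
have -> : M = N by rewrite /M /N; ring.
split; last by rewrite -[y in RHS]mulr1 -D1; ring.
by congr Complex; ring.
Qed.

Lemma cmulE (R : realType) (a b : R) : (a * b)%:C = a%:C * b%:C.
Proof. exact: rmorphM. Qed.
Lemma cinvE (R : realType) (a : R) : (a^-1)%:C = (a%:C)^-1.
Proof. exact: fmorphV. Qed.
Lemma caddE (R : realType) (a b : R) : (a + b)%:C = a%:C + b%:C.
Proof. exact: rmorphD. Qed.
Lemma cexpE (R : realType) (a : R) n : (a ^+ n)%:C = a%:C ^+ n.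
Proof. exact: rmorphXn. Qed.

Lemma conjM (R : realType) (v w : R[i]) : conjc (v * w) = conjc v * conjc w.
Proof. exact: rmorphM. Qed.
Lemma conjD (R : realType) (v w : R[i]) : conjc (v + w) = conjc v + conjc w.
Proof. exact: rmorphD. Qed.
Lemma conjV (R : realType) (v : R[i]) : conjc v^-1 = (conjc v)^-1.
Proof. exact: fmorphV. Qed.
Lemma conjX (R : realType) (v : R[i]) n : conjc (v ^+ n) = (conjc v) ^+ n.
Proof. exact: rmorphXn. Qed.

Lemma creal_eq0 (R : realType) (a : R) : (a%:C == 0) = (a == 0).
Proof. by rewrite eq_complex /= eqxx andbT. Qed.

Definition adj (R : realType) (g : 'M[R[i]]_2) : 'M[R[i]]_2 :=
  (map_mx (@conjc R) g)^T.

Lemma adjE (R : realType) (g : 'M[R[i]]_2) i j : adj g i j = conjc (g j i).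
Proof. by rewrite !mxE. Qed.

Lemma herm_mobius (R : realType) (g : 'M[R[i]]_2) (z : 'rV[R]_3) :
  SL2 g -> H3 z -> herm (mobius g z) = g *m herm z *m adj g.
Proof.
move=> gS z0; have J0 := jac_gt0 gS z0; have [Ez Eh] := mobiusE z gS.
have y0 : (ht z)%:C != 0 by rewrite creal_eq0 (gt_eqF z0).
have {}J0 : (jac g z)%:C != 0 by rewrite creal_eq0 (gt_eqF J0).
have JE : (jac g z)%:C = (g 1 0 * zx z + g 1 1) * conjc (g 1 0 * zx z + g 1 1) +
   g 1 0 * conjc (g 1 0) * (ht z)%:C ^+ 2.
  by rewrite /jac caddE cmulE !nsqE cexpE.
move: gS; rewrite /SL2 /= det2E => D.
have D' : conjc (g 0 0) * conjc (g 1 1) - conjc (g 0 1) * conjc (g 1 0) = 1.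
  by rewrite -!rmorphM -rmorphB D rmorph1.
move: D D' => /(canRL (subrK _)) D /(canRL (subrK _)) D'.
have cc (w : R[i]) : conjc (conjc w) = w by exact: conjcK.
have cr (w : R) : conjc w%:C = w%:C by exact: conjc_real.
(* This is |a z + b|^2 / |c z + d|^2 for quaternion norms. Clearing denominators leaves a polynomial
   identity modulo a d - b c = 1 and its conjugate. *)
have key : (nsq (zx (mobius g z)))%:C + (ht (mobius g z))%:C ^+ 2 =
  ((g 0 0 * zx z + g 0 1) * conjc (g 0 0 * zx z + g 0 1) +
   g 0 0 * conjc (g 0 0) * (ht z)%:C ^+ 2) / (jac g z)%:C.
  rewrite nsqE Ez Eh cmulE cinvE ?(conjM, conjD, conjV, conjX) ?cc ?cr cexpE.
  apply: (mulIf J0); apply: (mulIf J0).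
  rewrite divfK // [LHS](_ : _ =
   ((g 0 0 * zx z + g 0 1) * conjc (g 1 0 * zx z + g 1 1) +
      g 0 0 * conjc (g 1 0) * (ht z)%:C ^+ 2) *
   ((conjc (g 0 0) * conjc (zx z) + conjc (g 0 1)) * (g 1 0 * zx z + g 1 1) +
      conjc (g 0 0) * (g 1 0) * (ht z)%:C ^+ 2) + (ht z)%:C ^+ 2); last first.
    by rewrite ?(conjM, conjD, conjV, conjX) ?cc ?cr; field.
  rewrite JE ?(conjM, conjD).
  by ring: D D'.
have y'0 : (ht (mobius g z))%:C = (ht z)%:C / (jac g z)%:C.
  by rewrite Eh cmulE cinvE.
apply: matrix2P; rewrite !mul2E !mx2E !adjE.
- rewrite !(cmulE, cinvE) caddE [in RHS]caddE !cexpE key y'0 nsqE.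
  by rewrite ?(conjM, conjD); field; apply/andP.
- rewrite Ez y'0 !(cmulE, cinvE) caddE !cexpE nsqE.
  by rewrite ?(conjM, conjD); field; apply/andP.
- rewrite Ez y'0 !(cmulE, cinvE) caddE !cexpE nsqE.
  by rewrite ?(conjM, conjD, conjV, conjX) ?cc ?cr; field; apply/andP.
- rewrite cinvE y'0 !(cmulE, cinvE) caddE !cexpE nsqE invf_div JE.
  by rewrite ?(conjM, conjD); field.
Qed.

Lemma herm_inj (R : realType) (z w : 'rV[R]_3) :
  H3 z -> H3 w -> herm z = herm w -> z = w.
Proof.
rewrite /H3 /= => z0 w0 E.
have := congr1 (fun m : 'M[R[i]]_2 => m 1 1) E.
rewrite !mx2E => -[/invr_inj eh].
have := congr1 (fun m : 'M[R[i]]_2 => m 0 1) E.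
rewrite !mx2E eh => /mulIf; rewrite invr_eq0 creal_eq0 (gt_eqF w0) => /(_ isT) [e1 e2].
exact: row3_inj.
Qed.

Lemma SL2M (R : realType) (g h : 'M[R[i]]_2) : SL2 g -> SL2 h -> SL2 (g *m h).
Proof. by rewrite /SL2 /= det_mulmx => -> ->; rewrite mulr1. Qed.

Lemma SL2V (R : realType) (g : 'M[R[i]]_2) : SL2 g -> SL2 (invmx g).
Proof. by rewrite /SL2 /= det_inv => ->; rewrite invr1. Qed.

Lemma SL2_unit (R : realType) (g : 'M[R[i]]_2) : SL2 g -> g \in unitmx.
Proof. by rewrite /SL2 /= unitmxE => ->; exact: unitr1. Qed.

Lemma mobius_H3 (R : realType) (g : 'M[R[i]]_2) (z : 'rV[R]_3) :
  SL2 g -> H3 z -> H3 (mobius g z).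
Proof. by move=> gS z0; have [] := quat_of_mobius gS z0. Qed.

Lemma mobiusM (R : realType) (g h : 'M[R[i]]_2) (z : 'rV[R]_3) :
  SL2 g -> SL2 h -> H3 z -> mobius (g *m h) z = mobius g (mobius h z).
Proof.
move=> gS hS z0; have hz := mobius_H3 hS z0.
apply: herm_inj; [exact/mobius_H3/z0/SL2M | exact: mobius_H3 |].
rewrite !herm_mobius //; last exact: SL2M.
by rewrite /adj map_mxM trmx_mul !mulmxA.
Qed.

Lemma SL21 (R : realType) : SL2 (1%:M : 'M[R[i]]_2).
Proof. exact: det1. Qed.

Lemma mobius1 (R : realType) (z : 'rV[R]_3) : H3 z -> mobius 1%:M z = z.
Proof.
move=> z0; apply: herm_inj => //; first by apply: mobius_H3 z0; exact: SL21.
rewrite herm_mobius //; last exact: SL21.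
by rewrite /adj map_mx1 trmx1 mul1mx mulmx1.
Qed.

Lemma mobiusK (R : realType) (g : 'M[R[i]]_2) (z : 'rV[R]_3) :
  SL2 g -> H3 z -> mobius (invmx g) (mobius g z) = z.
Proof.
move=> gS z0; rewrite -(mobiusM (SL2V gS) gS z0).
by rewrite mulVmx; [exact: mobius1 | exact: SL2_unit].
Qed.

(** * The group Gamma *)

Lemma sqi (R : realType) : ci * ci = -1 :> R[i].
Proof. by apply/eqP; rewrite eq_complex /=; apply/andP; split; apply/eqP; ring. Qed.

Lemma sl2_basisE (R : realType) :
  ((sl2_basis R 0 = mx2 0 1 1 0) * (sl2_basis R 1 = mx2 0 ci (- ci) 0) *
   (sl2_basis R 2 = mx2 1 0 0 (-1)))%type.
Proof. by split; [split|]; apply: matrix2P; rewrite mx2E mxE. Qed.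

Lemma basis_sum (R : realType) (v : 'I_3 -> R[i]) :
  \sum_(k < 3) v k *: sl2_basis R k =
  mx2 (v 2) (v 0 + ci * v 1) (v 0 - ci * v 1) (- v 2).
Proof.
rewrite sum3E !sl2_basisE.
by apply: matrix2P; rewrite !mxE /=; ring.
Qed.

(** Closed form of c(g). Row 0 minus i times row 1 involves only the bottom row of g. *)
Definition conj_mx (R : realType) (g : 'M[R[i]]_2) : 'M[R[i]]_3 :=
  let a := g 0 0 in let b := g 0 1 in let c := g 1 0 in let d := g 1 1 in
  \matrix_(k < 3, j < 3) nth 0 (nth [::]
    [:: [:: (a ^+ 2 - b ^+ 2 + d ^+ 2 - c ^+ 2) / 2;
            ci * (a ^+ 2 + b ^+ 2 - c ^+ 2 - d ^+ 2) / 2; c * d - a * b];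
        [:: - ci * (a ^+ 2 - b ^+ 2 - d ^+ 2 + c ^+ 2) / 2;
            (a ^+ 2 + b ^+ 2 + c ^+ 2 + d ^+ 2) / 2; ci * (a * b + c * d)];
        [:: b * d - a * c; - ci * (a * c + b * d); a * d + b * c]] k) j.

Lemma is_conj_mx (R : realType) (g : 'M[R[i]]_2) :
  SL2 g -> is_conj_matrix g (conj_mx g).
Proof.
move=> gS; rewrite /is_conj_matrix => j; rewrite basis_sum (invmx2 gS).
move: gS; rewrite /SL2 /= det2E => /(canRL (subrK _)) D.
have I2 := sqi R.
by move: j; apply: ord3P; apply: matrix2P;
  rewrite !mul2E ?sl2_basisE !mxE /=; field: D I2.
Qed.

(** The diagonal of the image gives the Y-coordinate, and the off-diagonal entries give the sum and
    difference of the other two. This lets [conj_mx] replace the existential matrix in [Gamma]. *)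
Lemma conj_matrix_uniq (R : realType) (g : 'M[R[i]]_2) (M N : 'M[R[i]]_3) :
  is_conj_matrix g M -> is_conj_matrix g N -> M = N.
Proof.
move=> hM hN; apply/matrixP => i j; move: i.
have := hM j; rewrite hN !basis_sum => E.
have e k l := congr1 (fun m : 'M[R[i]]_2 => m k l) E.
have I2 := sqi R; have i0 : ci != 0 :> R[i].
  by rewrite eq_complex /= oner_eq0 andbF.
have two0 : 2 != 0 :> R[i] by rewrite pnatr_eq0.
have := e 0 0; have := e 0 1; have := e 1 0; rewrite !mx2E => h10 h01 h00.
apply: ord3P => //.
- apply: (mulfI two0); transitivity ((M 0 j + ci * M 1 j) + (M 0 j - ci * M 1 j)).
    by ring.
  by rewrite -h10 -h01; ring.
- apply: (mulfI i0); apply: (mulfI two0).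
  transitivity ((M 0 j + ci * M 1 j) - (M 0 j - ci * M 1 j)); first by ring.
  by rewrite -h10 -h01; ring.
Qed.

Lemma conj_mx_orth (R : realType) (g : 'M[R[i]]_2) :
  SL2 g -> (conj_mx g)^T *m conj_mx g = 1%:M.
Proof.
rewrite /SL2 /= det2E => /(canRL (subrK _)) D; have I2 := sqi R.
apply/matrixP => i j; rewrite !mxE sum3E.
by move: i; apply: ord3P; move: j; apply: ord3P; rewrite !mxE /= ?mulr0n ?mulr1n; field: D I2.
Qed.

Lemma det_conj_mx (R : realType) (g : 'M[R[i]]_2) : SL2 g -> \det (conj_mx g) = 1.
Proof.
rewrite /SL2 /= det2E => /(canRL (subrK _)) D; have I2 := sqi R.
rewrite (expand_det_row _ 0) sum3E /cofactor !det2E !mxE /=.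
rewrite !expr0 !expr1 ?sqrrN ?expr1n.
by field: D I2.
Qed.

Lemma GammaP (R : realType) (g : 'M[R[i]]_2) :
  Gamma g <-> SL2 g /\ forall k l, gaussian_int (conj_mx g k l).
Proof.
split.
  move=> [gS [M hM [_ _ hg]]]; split=> // k l.
  by rewrite -(conj_matrix_uniq hM (is_conj_mx gS)).
move=> [gS hg]; split=> //; exists (conj_mx g); first exact: is_conj_mx.
by split; [exact: conj_mx_orth | exact: det_conj_mx |].
Qed.

Lemma Gamma_SL2 (R : realType) : @Gamma R `<=` @SL2 R.
Proof. by move=> g []. Qed.

(** * Gaussian integers, and Gamma as a group *)

Lemma gauss0 (R : realType) : gaussian_int (0 : R[i]).
Proof. by exists 0, 0. Qed.

Lemma gauss1 (R : realType) : gaussian_int (1 : R[i]).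
Proof. by exists 1, 0. Qed.

Lemma gaussi (R : realType) : gaussian_int (ci : R[i]).
Proof. by exists 0, 1. Qed.

Lemma gaussD (R : realType) (v w : R[i]) :
  gaussian_int v -> gaussian_int w -> gaussian_int (v + w).
Proof. by move=> [a [b ->]] [c [d ->]]; exists (a + c), (b + d); rewrite !intrD. Qed.

Lemma gaussN (R : realType) (w : R[i]) : gaussian_int w -> gaussian_int (- w).
Proof. by move=> [a [b ->]]; exists (- a), (- b); rewrite !mulrNz. Qed.

Lemma gaussB (R : realType) (v w : R[i]) :
  gaussian_int v -> gaussian_int w -> gaussian_int (v - w).
Proof. by move=> hv hw; apply: gaussD => //; exact: gaussN. Qed.

Lemma gaussM (R : realType) (v w : R[i]) :
  gaussian_int v -> gaussian_int w -> gaussian_int (v * w).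
Proof.
move=> [a [b ->]] [c [d ->]]; exists (a * c - b * d), (a * d + b * c).
by apply/eqP; rewrite eq_complex /= !intrD mulrNz !intrM !eqxx.
Qed.

Lemma conj_matrixM (R : realType) (g h : 'M[R[i]]_2) (M N : 'M[R[i]]_3) :
  SL2 g -> SL2 h ->
  is_conj_matrix g M -> is_conj_matrix h N -> is_conj_matrix (g *m h) (M *m N).
Proof.
move=> gS hS hM hN j.
have -> : invmx (g *m h) = invmx h *m invmx g.
  have u := SL2_unit (SL2M gS hS).
  apply: (can_inj (mulKmx u)); rewrite mulmxV // !mulmxA.
  by rewrite mulmxK ?SL2_unit // mulmxV ?SL2_unit.
rewrite !mulmxA -(mulmxA g h) -(mulmxA g) hN mulmx_sumr mulmx_suml.
under eq_bigr do rewrite -scalemxAr -scalemxAl hM scaler_sumr.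
rewrite exchange_big /=; apply: eq_bigr => k _.
rewrite mxE scaler_suml; apply: eq_bigr => l _.
by rewrite scalerA mulrC.
Qed.

Lemma GammaM (R : realType) (g h : 'M[R[i]]_2) :
  Gamma g -> Gamma h -> Gamma (g *m h).
Proof.
move=> [gS [M hM [M1 M2 M3]]] [hS [N hN [N1 N2 N3]]]; split; first exact: SL2M.
exists (M *m N); first exact: conj_matrixM.
split.
- by rewrite trmx_mul -mulmxA (mulmxA _ M) M1 mul1mx.
- by rewrite det_mulmx M2 N2 mulr1.
- by move=> k l; rewrite mxE sum3E; apply: gaussD; [apply: gaussD|]; exact: gaussM.
Qed.

(** The inverse of an orthogonal matrix is its transpose, whose entries are again Gaussian integers.
    Expanding X_j through M M^T = 1 shows that M^T represents conjugation by the inverse of g. *)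
Lemma GammaV (R : realType) (g : 'M[R[i]]_2) : Gamma g -> Gamma (invmx g).
Proof.
move=> [gS [M hM [M1 M2 M3]]]; split; first exact: SL2V.
have MM : M *m M^T = 1%:M by exact: mulmx1C.
exists M^T; last first.
  by rewrite /SO3_Zi /= trmxK det_tr; split=> // k l; rewrite mxE.
move=> j; rewrite invmxK.
have hk k : invmx g *m (g *m sl2_basis R k *m invmx g) *m g = sl2_basis R k.
  by rewrite !mulmxA mulVmx ?SL2_unit // mul1mx mulmxKV // SL2_unit.
have -> : sl2_basis R j = \sum_(k < 3) (M *m M^T) k j *: sl2_basis R k.
  rewrite MM (bigD1 j) //= mxE eqxx scale1r big1 ?addr0 // => k kj.
  by rewrite mxE (negbTE kj) scale0r.
rewrite (_ : \sum_(k < 3) _ = \sum_(l < 3) M^T l j *: (g *m sl2_basis R l *m invmx g)).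
  rewrite mulmx_sumr mulmx_suml; apply: eq_bigr => k _.
  by rewrite -scalemxAr -scalemxAl hk.
under [RHS]eq_bigr do rewrite hM scaler_sumr.
rewrite exchange_big /=; apply: eq_bigr => k _.
rewrite mxE scaler_suml; apply: eq_bigr => l _.
by rewrite scalerA mulrC.
Qed.

Lemma Gamma1 (R : realType) : Gamma (1%:M : 'M[R[i]]_2).
Proof.
split; first exact: SL21.
exists 1%:M.
  move=> j; rewrite invmx1 mulmx1 mul1mx (bigD1 j) //= mxE eqxx scale1r.
  by rewrite big1 ?addr0 // => k kj; rewrite mxE (negbTE kj) scale0r.
split; [by rewrite trmx1 mulmx1 | exact: det1 |].
by move=> k l; rewrite mxE; case: eqP => _; [exact: gauss1 | exact: gauss0].
Qed.

(** * Arithmetic of the bottom row *)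

(** Keeps the integer coordinates visible, so that identities in R[i] descend to identities in Z
    through [gint_inj]. *)
Definition gint (R : realType) (m n : int) : R[i] := m%:~R +i* n%:~R.

Lemma gintD (R : realType) m n m' n' :
  gint R m n + gint R m' n' = gint R (m + m') (n + n').
Proof. by rewrite /gint !intrD. Qed.

Lemma gintN (R : realType) m n : - gint R m n = gint R (- m) (- n).
Proof. by rewrite /gint !mulrNz. Qed.

Lemma gintM (R : realType) m n m' n' :
  gint R m n * gint R m' n' = gint R (m * m' - n * n') (m * n' + m' * n).
Proof.
by apply/eqP; rewrite eq_complex /= !intrD mulrNz !intrM (mulrC m'%:~R) !eqxx.
Qed.

Lemma gint_inj (R : realType) m n m' n' :
  gint R m n = gint R m' n' -> m = m' /\ n = n'.
Proof. by case=> /intr_inj -> /intr_inj ->. Qed.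

Lemma gint10 (R : realType) : 1 = gint R 1 0. Proof. by []. Qed.
Lemma gintci (R : realType) : ci = gint R 0 1. Proof. by []. Qed.

(* Used with e = 2 c^2, t = d^2 - c^2, q = 2 c d, in real and imaginary parts:
   |e|^2 = 2 is excluded by a parity argument modulo 1 + i. *)
Lemma gauss_arith (p1 p1' p2 p2' p3 p3' t t' e e' q q' : int) :
  (p1 * t - p1' * t') + (p2 * (t + e) - p2' * (t' + e')) +
    (p3 * q - p3' * q') = 1 ->
  (p1 * t' + p1' * t) + (p2 * (t' + e') + p2' * (t + e)) +
    (p3 * q' + p3' * q) = 0 ->
  e * (2 * t + e) - e' * (2 * t' + e') = q * q - q' * q' ->
  e * (2 * t' + e') + e' * (2 * t + e) = 2 * (q * q') ->
  [\/ e = 0 /\ e' = 0,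
      e * e + e' * e' = 1 /\ exists k, q + q' = 2 * k + 1 |
      4 <= e * e + e' * e'].
Proof.
move=> E1 E2 E3 E4.
have bit (x : int) : exists k, x = 2 * k \/ x = 2 * k + 1.
  by exists (x %/ 2)%Z; lia.
have [big|small] := lerP 4 (e * e + e' * e'); first by constructor 3.
have he : e = -1 \/ e = 0 \/ e = 1 by nia.
have he' : e' = -1 \/ e' = 0 \/ e' = 1 by nia.
(* Divisibility of q + q' i by 1 + i is the parity of q + q'. *)
have [k hk] := bit (q + q').
have odd_case : e * e + e' * e' = 1 -> exists k, q + q' = 2 * k + 1.
  move=> e1; exists k; case: hk => // hk; exfalso.
  have {}hk : q = 2 * k - q' by lia.
  by subst q; case: he => [?|[?|?]]; case: he' => [?|[?|?]]; subst e e'; lia.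
have even_case : e * e + e' * e' = 2 -> False.
  move=> e2.
  (* Modulo 1 + i the square q^2 = e (2 t + e) vanishes, so 1 + i divides q. *)
  have {}hk : q = 2 * k - q'.
    case: hk => hk; first lia.
    exfalso; have {}hk : q = 2 * k + 1 - q' by lia.
    by subst q; case: he => [?|[?|?]]; case: he' => [?|[?|?]]; subst e e'; lia.
  (* Then 2 t e = q^2 - e^2 forces 1 + i to divide t, hence also t + e, and so the pairing whose
     value is 1. *)
  subst q; have [l hl] := bit (t + t').
  have {}hl : t = 2 * l - t'.
    case: hl => hl; first lia.
    exfalso; have {}hl : t = 2 * l + 1 - t' by lia.
    by subst t; case: he => [?|[?|?]]; case: he' => [?|[?|?]]; subst e e'; lia.
  by subst t; case: he => [?|[?|?]]; case: he' => [?|[?|?]]; subst e e'; lia.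
case: he => [?|[?|?]]; case: he' => [?|[?|?]]; subst e e';
 by [constructor 1; split | exfalso; apply: even_case |
     constructor 2; split; [|exact: odd_case]].
Qed.

(** Row 0 minus i times row 1 of [conj_mx g] is (t, -i s, q) with t = d^2 - c^2, s = d^2 + c^2 and q
    = 2 c d; the integers e and f are s - t and s + t. *)
Lemma Gamma_bottom_row (R : realType) (g : 'M[R[i]]_2) : Gamma g ->
  exists e e' q q' f f' : int,
  [/\ 2 * g 1 0 ^+ 2 = gint R e e', 2 * g 1 0 * g 1 1 = gint R q q',
      2 * g 1 1 ^+ 2 = gint R f f' &
  [\/ e = 0 /\ e' = 0,
      e * e + e' * e' = 1 /\ exists k, q + q' = 2 * k + 1 |
      4 <= e * e + e' * e']].
Proof.
move=> gG; have [gS hg] := (GammaP g).1 gG; have I2 := sqi R.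
have /(canRL (subrK _)) D : g 0 0 * g 1 1 - g 0 1 * g 1 0 = 1.
  by rewrite -det2E.
set c := g 1 0; set d := g 1 1.
have [p1 [p1' E1]] := hg 0 0.
(* The factor -i of the middle coordinate is moved onto the entry it is paired with. *)
have [p2 [p2' E2]] : gaussian_int (- ci * conj_mx g 0 1).
  by apply: gaussM; [apply: gaussN; exact: gaussi | exact: hg].
have [p3 [p3' E3]] := hg 0 2.
have [t [t' Et]] : gaussian_int (d ^+ 2 - c ^+ 2).
  rewrite (_ : _ - _ = conj_mx g 0 0 - ci * conj_mx g 1 0); last first.
    by rewrite !mxE /= -/c -/d; field: I2.
  by apply: gaussB => //; apply: gaussM; [exact: gaussi |].
have [s [s' Es]] : gaussian_int (d ^+ 2 + c ^+ 2).
  rewrite (_ : _ + _ = conj_mx g 1 1 + ci * conj_mx g 0 1); last first.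
    by rewrite !mxE /= -/c -/d; field: I2.
  by apply: gaussD => //; apply: gaussM; [exact: gaussi |].
have [q [q' Eq]] : gaussian_int (2 * c * d).
  rewrite (_ : 2 * _ * _ = conj_mx g 0 2 - ci * conj_mx g 1 2); last first.
    by rewrite !mxE /= -/c -/d; ring: I2.
  by apply: gaussB => //; apply: gaussM; [exact: gaussi |].
rewrite -!/(gint R _ _) in E1 E2 E3 Et Es Eq.
exists (s - t), (s' - t'), q, q', (s + t), (s' + t'); split=> //.
- by rewrite -!gintD -gintN -Es -Et; ring.
- by rewrite -!gintD -Es -Et; ring.
(* [F1] is the orthonormality of the first two rows, [F2] the isotropy of their combination. *)
have F1 : gint R p1 p1' * gint R t t' + gint R p2 p2' * gint R s s' +
    gint R p3 p3' * gint R q q' = 1.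
  by rewrite -E1 -E2 -E3 -Et -Es -Eq !mxE /= /c /d; field: D I2.
have F2 : gint R s s' * gint R s s' - gint R t t' * gint R t t' =
    gint R q q' * gint R q q'.
  by rewrite -Et -Es -Eq; ring.
move: F1 F2; rewrite gint10 !gintM !(gintN, gintD) => /gint_inj[A1 A2] /gint_inj[A3 A4].
apply: (@gauss_arith p1 p1' p2 p2' p3 p3' t t'); lia.
Qed.

Lemma nsq_gint (R : realType) m n : nsq (gint R m n) = (m * m + n * n)%:~R.
Proof. by rewrite /nsq /= intrD !intrM !expr2. Qed.

Lemma Gamma_c0 (R : realType) (g : 'M[R[i]]_2) : Gamma g -> g 1 0 = 0 ->
  exists e e' t t' k : int,
  [/\ e * e + e' * e' = 1, t + t' = 2 * k,
      g 0 0 ^+ 2 = gint R e e', g 0 0 * g 0 1 = gint R t t' & nsq (g 1 1) = 1].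
Proof.
move=> gG c0; have [gS hg] := (GammaP g).1 gG; have I2 := sqi R.
have D : g 0 0 * g 1 1 = 1.
  by move: gS; rewrite /SL2 /= det2E c0 mulr0 subr0.
set a := g 0 0; set b := g 0 1; set d := g 1 1.
have [p1 [p1' E1]] := hg 0 0.
have [p2 [p2' E2]] := hg 0 1.
have [p3 [p3' E3]] := hg 0 2.
have [f [f' Ef]] : gaussian_int (d ^+ 2).
  rewrite (_ : _ ^+ 2 = conj_mx g 1 1 + ci * conj_mx g 0 1); last first.
    by rewrite !mxE /= c0 -/d; field: I2.
  by apply: gaussD => //; apply: gaussM; [exact: gaussi |].
rewrite -!/(gint R _ _) in E1 E2 E3 Ef.
have Ea : a ^+ 2 = gint R (p1 + p2') (p1' - p2).
  transitivity (gint R p1 p1' - ci * gint R p2 p2'); last first.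
    by rewrite gintci gintM gintN gintD; congr gint; lia.
  by rewrite -E1 -E2 !mxE /= c0 -/a -/d; field: I2.
have Eb : a * b = gint R (- p3) (- p3').
  by rewrite -gintN -E3 !mxE /= c0 -/a -/b; ring.
have F1 : gint R p1 p1' * gint R p1 p1' + gint R p2 p2' * gint R p2 p2' +
    gint R p3 p3' * gint R p3 p3' = 1.
  have := congr1 (fun m : 'M[R[i]]_3 => m 0 0) (mulmx1C (conj_mx_orth gS)).
  by rewrite mxE sum3E !mxE -E1 -E2 -E3 !mxE.
have F2 : gint R (p1 + p2') (p1' - p2) * gint R f f' = 1.
  by rewrite -Ea -Ef -exprMn D expr1n.
have N1 : nsq (a ^+ 2) * nsq (d ^+ 2) = 1.
  by rewrite -nsqM -exprMn D expr1n /nsq /= expr1n expr0n addr0.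
move: F1 F2 (N1); rewrite gint10 !gintM !gintD => /gint_inj[A1 A2] /gint_inj[A3 A4].
rewrite Ea Ef !nsq_gint -intrM => /(@intr_inj R _ 1) N2.
have u1 : (p1 + p2') * (p1 + p2') + (p1' - p2) * (p1' - p2) = 1.
  have pos (m n : int) : 0 <= m * m + n * n by nia.
  move: N2 (pos (p1 + p2') (p1' - p2)) (pos f f').
  set A := _ + _; set B := _ + _ => AB A0 B0.
  have B1 : B != 0 by apply/eqP => hB; move: AB; rewrite hB mulr0.
  have nA : A != 0 by apply/eqP => hA; move: AB; rewrite hA mul0r.
  have : 0 <= A * (B - 1) by apply: mulr_ge0; lia.
  by rewrite mulrBr mulr1 AB; lia.
have [k hk] : exists k, p3 + p3' = 2 * k.
  exists ((p3 + p3') %/ 2)%Z.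
  have [r hr] : exists r, p3 + p3' = 2 * r \/ p3 + p3' = 2 * r + 1.
    by exists ((p3 + p3') %/ 2)%Z; lia.
  case: hr => hr; first lia.
  exfalso; have {}hr : p3 = 2 * r + 1 - p3' by lia.
  by subst p3; lia.
exists (p1 + p2'), (p1' - p2), (- p3), (- p3'), (- k); split => //; first lia.
move: N1; rewrite Ea nsq_gint u1 mul1r expr2 nsqM -expr2 => /eqP.
rewrite -subr_eq0 subr_sqr_1 mulf_eq0 => /orP[|]; first by rewrite subr_eq0 => /eqP.
by rewrite paddr_eq0 ?nsq_ge0 // oner_eq0 andbF.
Qed.

(** * The triangle against the isometric spheres *)

Definition in_tri (R : realType) (x y : R) := [/\ 1 <= x, 0 <= y & x + y <= 2].

(** The level 2 is the hemisphere about 1 of radius sqrt 2, which passes through the three finite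
    vertices of the polytope. *)
Definition sph (R : realType) (z : 'rV[R]_3) : R :=
  (x1 z - 1) ^+ 2 + x2 z ^+ 2 + ht z ^+ 2.

(* Among the lattice points congruent to 1 modulo 1 + i, the vertex 1 is nearest
   to any point of the triangle. *)
Lemma nsq_ge_tri (R : realType) (e e' q q' k : int) (x y : R) :
  in_tri x y -> e * e + e' * e' = 1 -> q + q' = 2 * k + 1 ->
  (x - 1) ^+ 2 + y ^+ 2 <= nsq (gint R e e' * (x +i* y) + gint R q q').
Proof.
move=> [hx hy hxy] he hq.
have key (n n' l : int) : n + n' = 2 * l ->
    (x - 1) ^+ 2 + y ^+ 2 <= (x - 1 + n%:~R) ^+ 2 + (y + n'%:~R) ^+ 2.
  move=> hl; rewrite -subr_ge0.
  (* The difference of the two squared distances is affine in the point; it is expanded in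
     barycentric coordinates, and its values at the vertices are integers. *)
  rewrite [leRHS](_ : _ = (1 - (x - 1) - y) * (n * n + n' * n')%:~R +
    (x - 1) * (n * n + n' * n' + 2 * n)%:~R +
    y * (n * n + n' * n' + 2 * n')%:~R); last first.
    by rewrite !(intrD, intrM); ring.
  (* The expression is |(m + 1) + m' i|^2 - 1, and (m + 1) + m' i is odd, hence nonzero. *)
  have hn (m m' : int) : m + m' = 2 * l -> 0 <= m * m + m' * m' + 2 * m.
    move=> hm; have [m0|m0] := lerP 0 m; first by nia.
    have [m1|m1] := lerP m (-2); first by nia.
    have em : m = -1 by lia.
    have : m' != 0 by apply/eqP; lia.
    by subst m => m'0; nia.
  rewrite !addr_ge0 // mulr_ge0 ?ler0z //; try lra.
  - by nia.
  - exact: hn.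
  - by rewrite (addrC (n * n)); apply: hn; rewrite addrC.
have h1 : e = -1 \/ e = 0 \/ e = 1 by nia.
have h2 : e' = -1 \/ e' = 0 \/ e' = 1 by nia.
rewrite /nsq /gint /=.
(* Dividing by the unit e + e' i, which preserves the norm, turns q + q' i into an odd number; its
   sum with 1 is the even translation given to [key]. *)
case: h1 => [?|[?|?]]; case: h2 => [?|[?|?]]; subst e e' => //.
- apply: le_trans (key (1 - q) (- q') (- k) _) _; first lia.
  by rewrite !(intrD, mulrNz) le_eqVlt; apply/orP; left; apply/eqP; ring.
- apply: le_trans (key (1 - q') q (k + 1 - q') _) _; first lia.
  by rewrite !(intrD, mulrNz) le_eqVlt; apply/orP; left; apply/eqP; ring.
- apply: le_trans (key (q' + 1) (- q) (k + 1 - q) _) _; first lia.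
  by rewrite !(intrD, mulrNz) le_eqVlt; apply/orP; left; apply/eqP; ring.
- apply: le_trans (key (q + 1) (q') (k + 1) _) _; first lia.
  by rewrite !(intrD, mulrNz) le_eqVlt; apply/orP; left; apply/eqP; ring.
Qed.

(** If |c|^2 = 1/2, then |c x + d|^2 is half the squared distance from x to an odd Gaussian integer,
    and 1 is the nearest such. If |c|^2 >= 1, the height alone contributes y^2, and |x - 1|^2 <= 1
    on the triangle. *)
Lemma jac_bound (R : realType) (g : 'M[R[i]]_2) (z : 'rV[R]_3) :
  Gamma g -> g 1 0 != 0 -> in_tri (x1 z) (x2 z) ->
  sph z / 2 <= jac g z \/ sph z - 1 <= jac g z.
Proof.
move=> gG c0 T; have [e [e' [q [q' [f [f' [Ee Eq _ C]]]]]]] := Gamma_bottom_row gG.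
have N2 : nsq (2 : R[i]) = 4 by rewrite /nsq /=; ring.
have n4 : 4 * nsq (g 1 0) ^+ 2 = (e * e + e' * e')%:~R.
  by rewrite -nsq_gint -Ee nsqM N2 [g 1 0 ^+ 2]expr2 nsqM expr2.
have nc0 := nsq_ge0 (g 1 0).
have [hx hy hxy] := T.
case: C => [[e0 e0']|[e1 [k hk]]|e4].
- exfalso; move: Ee; rewrite e0 e0' => /eqP.
  by rewrite mulf_eq0 pnatr_eq0 /= sqrf_eq0 (negbTE c0).
- left; move: n4; rewrite e1 => n4.
  have nc : nsq (g 1 0) = 2^-1 by nra.
  have E : nsq (gint R e e' * zx z + gint R q q') = 2 * nsq (g 1 0 * zx z + g 1 1).
    rewrite -Ee -Eq (_ : _ + _ = 2 * g 1 0 * (g 1 0 * zx z + g 1 1)); last by ring.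
    by rewrite !nsqM N2 nc; field.
  have := nsq_ge_tri T e1 hk; rewrite -/(zx z) E => h.
  by rewrite /jac nc /sph; lra.
- right; have {}n4 : 4 <= 4 * nsq (g 1 0) ^+ 2.
    by rewrite n4 -[4]/(4%:~R) ler_int.
  have n1 : 1 <= nsq (g 1 0) by nra.
  have := nsq_ge0 (g 1 0 * zx z + g 1 1).
  have : ht z ^+ 2 <= nsq (g 1 0) * ht z ^+ 2 by rewrite ler_peMl ?sqr_ge0.
  have : (x1 z - 1) ^+ 2 + x2 z ^+ 2 <= 1 by nra.
  by rewrite /jac /sph; lra.
Qed.

(** * Description of the Grenier domain *)

Lemma gint20 (R : realType) : 2 = gint R 2 0.
Proof. by apply/eqP; rewrite eq_complex /=; apply/andP; split; apply/eqP; ring. Qed.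

Lemma nsq0 (R : realType) : nsq (0 : R[i]) = 0.
Proof. by rewrite /nsq /= expr0n addr0. Qed.

Lemma le_phi1 (R : realType) (z w : 'rV[R]_3) : H3 z -> H3 w ->
  (phi1 z <= phi1 w) = (ht w <= ht z).
Proof. by move=> z0 w0; rewrite /phi1 lerN2 ler_ln. Qed.

Lemma phi1_inj (R : realType) (z w : 'rV[R]_3) : H3 z -> H3 w ->
  phi1 z = phi1 w -> ht z = ht w.
Proof. by move=> z0 w0 /oppr_inj /ln_inj; apply. Qed.

Lemma le_phi1_mobius (R : realType) (g : 'M[R[i]]_2) (z : 'rV[R]_3) :
  SL2 g -> H3 z -> (phi1 z <= phi1 (mobius g z)) = (1 <= jac g z).
Proof.
move=> gS z0; rewrite le_phi1 //; last exact: mobius_H3.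
have [_ ->] := mobiusE z gS.
by rewrite ler_pdivrMr ?jac_gt0 // ler_pMr.
Qed.

Lemma mobius_c0 (R : realType) (g : 'M[R[i]]_2) (z : 'rV[R]_3) :
  Gamma g -> g 1 0 = 0 ->
  zx (mobius g z) = g 0 0 ^+ 2 * zx z + g 0 0 * g 0 1 /\
  ht (mobius g z) = ht z.
Proof.
move=> gG c0; have [_ [_ [_ [_ [_ [_ _ _ _ d1]]]]]] := Gamma_c0 gG c0.
have gS := Gamma_SL2 gG; have [-> ->] := mobiusE z gS.
have D : g 0 0 * g 1 1 = 1.
  by move: gS; rewrite /SL2 /= det2E c0 mulr0 subr0.
have dd : conjc (g 1 1) = g 0 0.
  rewrite -[LHS]mul1r -D -mulrA.
  by rewrite -nsqE d1 mulr1.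
have J1 : jac g z = 1 by rewrite /jac c0 mul0r add0r d1 nsq0 mul0r addr0.
rewrite J1 invr1 mulr1 c0 mul0r add0r dd conjc0 mulr0 mul0r addr0.
by split=> //; ring.
Qed.

(** Above the origin, preserving the height means |d|^2 + |c|^2 y^2 = 1; the heights 1 and 2
    together force c = 0. *)
Lemma stab1P (R : realType) (g : 'M[R[i]]_2) :
  stab1 (@Gamma R) g <-> Gamma g /\ g 1 0 = 0.
Proof.
split=> [[gG h]|[gG c0]]; last first.
  by split=> // z z0; rewrite /phi1; have [_ ->] := mobius_c0 z gG c0.
split=> //; have gS := Gamma_SL2 gG.
have j1 y : 0 < y -> jac g (row3 0 0 y) = 1.
  move=> y0; have z0 : H3 (row3 0 0 y : 'rV[R]_3) by rewrite /H3 /= /ht mxE.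
  have := phi1_inj (mobius_H3 gS z0) z0 (h _ z0).
  have [_ ->] := mobiusE (row3 0 0 y) gS.
  have [_ _ ->] := row3K (0 : R) 0 y.
  move=> /(canRL (divfK (lt0r_neq0 (jac_gt0 gS z0)))) /eqP.
  by rewrite eq_sym -subr_eq0 -[X in _ - X]mulr1 -mulrBr mulf_eq0 (gt_eqF y0) subr_eq0 => /eqP.
have := j1 1 ltr01; have := j1 2 (ltr0n _ 2).
rewrite /jac /zx; have [-> -> ->] := row3K (0 : R) 0 1.
have [-> -> ->] := row3K (0 : R) 0 2 => h2 h1.
by apply/eqP; rewrite -nsq_eq0; apply/eqP; lra.
Qed.

(** Converse of [Gamma_c0]. The halves in [conj_mx] are harmless: T = a b is divisible by 1 + i, so
    T^2 is twice a Gaussian integer, and the sum and difference of a^2 and its conjugate are 2 e and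
    2 i e'. *)
Lemma stab_mem (R : realType) (a : R[i]) (e e' t t' k : int) :
  nsq a = 1 -> a ^+ 2 = gint R e e' -> t + t' = 2 * k ->
  Gamma (mx2 a (conjc a * gint R t t') 0 (conjc a)).
Proof.
move=> a1 a2 ht; set d := conjc a; set T := gint R t t'.
have ad : a * d = 1 by rewrite -nsqE a1.
have d2 : d ^+ 2 = gint R e (- e').
  by rewrite -conjX a2 /gint /= mulrNz.
have gauss m n : gaussian_int (gint R m n) by exists m, n.
have T2 : T ^+ 2 = 2 * gint R (k * (t - t')) (t * t').
  rewrite expr2 gintM (@gint20 R) gintM; congr gint; last by lia.
  have -> : t = 2 * k - t' by lia.
  by lia.
have gci := @gaussi R.
apply/GammaP; split.
  by rewrite /SL2 /= det2E !mx2E mulr0 subr0.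
have two0 : 2 != 0 :> R[i] by rewrite pnatr_eq0.
have half (u v : R[i]) : u = 2 * v -> u / 2 = v.
  by move=> ->; rewrite mulrC mulKf.
set B := gint R (k * (t - t')) (t * t') in T2.
have b2 : (d * T) ^+ 2 = 2 * (gint R e (- e') * B).
  by rewrite exprMn T2 d2; ring.
have aM : a ^+ 2 - d ^+ 2 = 2 * (ci * gint R e' 0).
  rewrite a2 d2 gintN gintD gintci gintM (@gint20 R) gintM.
  by congr gint; lia.
have aP : a ^+ 2 + d ^+ 2 = 2 * gint R e 0.
  rewrite a2 d2 gintD (@gint20 R) gintM.
  by congr gint; lia.
have gB : gaussian_int (gint R e (- e') * B) by apply: gaussM; exact: gauss.
have gd2 : gaussian_int (d ^+ 2) by rewrite d2.
apply: ord3P; apply: ord3P; rewrite !mxE /= ?mul0r ?mulr0 ?expr0n ?subr0 ?addr0 ?add0r.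
- have -> := half _ (gint R e 0 - gint R e (- e') * B).
    by apply: gaussB; [exact: gauss | exact: gB].
  by rewrite mulrBr -b2 -aP; ring.
- rewrite -mulrA; have -> := half _ (ci * gint R e' 0 + gint R e (- e') * B).
    by apply: gaussM => //; apply: gaussD => //; apply: gaussM.
  by rewrite mulrDr -b2 -aM; ring.
- by rewrite mulrA ad mul1r; exact/gaussN/gauss.
- rewrite -mulrA; have -> := half _ (ci * gint R e' 0 - gint R e (- e') * B).
    by apply: gaussM; [exact: gaussN | apply: gaussB => //; apply: gaussM].
  by rewrite mulrBr -b2 -aM; ring.
- have -> := half _ (gint R e 0 + gint R e (- e') * B).
    by apply: gaussD; [exact: gauss | exact: gB].
  by rewrite mulrDr -b2 -aP; ring.
- by rewrite [a * _]mulrA ad mul1r; apply: gaussM; [|exact: gauss].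
- by rewrite mulrAC -expr2; apply: gaussM; [|exact: gauss].
- by rewrite mulrAC -expr2; apply: gaussM; [exact: gaussN | apply: gaussM; [|exact: gauss]].
- by rewrite ad; exact: gauss1.
Qed.

(** The element acts on C with linear part a^2, so the rotation x |-> i x requires a primitive
    eighth root of unity. *)
Lemma unit_root (R : realType) (e e' : int) : e * e + e' * e' = 1 ->
  exists a : R[i], nsq a = 1 /\ a ^+ 2 = gint R e e'.
Proof.
move=> h.
have s2 : Num.sqrt 2^-1 ^+ 2 = 2^-1 :> R by rewrite sqr_sqrtr // invr_ge0.
set s := Num.sqrt 2^-1 in s2.
have h1 : e = -1 \/ e = 0 \/ e = 1 by nia.
have h2 : e' = -1 \/ e' = 0 \/ e' = 1 by nia.
case: h1 => [?|[?|?]]; case: h2 => [?|[?|?]]; subst e e' => //.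
- exists ci; split; first by rewrite /nsq /=; ring.
  by rewrite expr2 sqi gint10 gintN oppr0.
- exists (s +i* - s); split; first by rewrite /nsq /= sqrrN s2; lra.
  rewrite expr2; apply/eqP; rewrite eq_complex /= mulrNz.
  by apply/andP; split; apply/eqP; [ring | lra].
- exists (s +i* s); split; first by rewrite /nsq /= s2; lra.
  rewrite expr2; apply/eqP; rewrite eq_complex /=.
  by apply/andP; split; apply/eqP; [ring | lra].
- exists 1; split; first by rewrite /nsq /=; ring.
  by rewrite expr1n.
Qed.

Lemma stab_ex (R : realType) (e e' t t' k : int) : e * e + e' * e' = 1 ->
  t + t' = 2 * k ->
  exists g : 'M[R[i]]_2, [/\ Gamma g, g 1 0 = 0, g 0 0 ^+ 2 = gint R e e' &
    g 0 0 * g 0 1 = gint R t t'].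
Proof.
move=> /(@unit_root R) [a [a1 a2]] ht.
exists (mx2 a (conjc a * gint R t t') 0 (conjc a)).
split; rewrite ?mx2E //; first exact: (stab_mem a1 a2 ht).
by rewrite mulrA -nsqE a1 mul1r.
Qed.

(* An element whose isometric sphere is the hemisphere [sph z = 2]. *)
Lemma flip_ex (R : realType) :
  exists2 g : 'M[R[i]]_2, Gamma g & forall z, jac g z = sph z / 2.
Proof.
have s2 : Num.sqrt 2^-1 ^+ 2 = 2^-1 :> R by rewrite sqr_sqrtr // invr_ge0.
set s := Num.sqrt 2^-1 in s2; pose h := s%:C.
have h2 : h ^+ 2 = 2^-1 by rewrite -cexpE s2 cinvE; congr (_^-1); exact: (rmorph_nat (real_complex R)).
have h1 : h * h + h * h = 1.
  by rewrite -expr2 h2; field.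
(* With h = 1/sqrt 2, the choice c = h, d = -h puts the centre -d/c at 1 with |c|^2 = 1/2; c(g) is
   then a signed permutation matrix. *)
exists (mx2 (- h) (- h) h (- h)).
  apply/GammaP; split.
    by rewrite /SL2 /= det2E !mx2E -h1; ring.
  have g0 x : x = 0 -> gaussian_int (x : R[i]) by move=> ->; exact: gauss0.
  have g1 x : x = 1 -> gaussian_int (x : R[i]) by move=> ->; exact: gauss1.
  have gN x : x = -1 -> gaussian_int (x : R[i]).
    by move=> ->; exact/gaussN/gauss1.
  apply: ord3P; apply: ord3P; rewrite !mxE /=;
  by [apply: g0; field | apply: g1; transitivity (h * h + h * h); [field|] |
      apply: gN; transitivity (- (h * h + h * h)); [field | rewrite h1]].
move=> z; rewrite /jac !mx2E /sph /zx.
transitivity (s ^+ 2 * ((x1 z - 1) ^+ 2 + x2 z ^+ 2 + ht z ^+ 2)).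
  by rewrite /nsq /h /=; ring.
by rewrite s2 mulrC.
Qed.

(** The element of [flip_ex] imposes [sph z >= 2]; conversely this inequality makes both bounds of
    [jac_bound] at least 1. *)
Lemma grenier_triE (R : realType) (G : set (R * R)) :
  (forall p, G p <-> in_tri p.1 p.2) ->
  grenier (@Gamma R) G =
  [set z | [/\ H3 z, in_tri (x1 z) (x2 z) & 2 <= sph z]].
Proof.
move=> GE; apply/seteqP; split=> z.
  move=> [[z0 zF] /GE T]; split=> //.
  have [g gG gj] := flip_ex R.
  have := zF _ gG; rewrite le_phi1_mobius ?gj //; last exact: Gamma_SL2.
  by rewrite ler_pdivlMr // mul1r.
move=> [z0 T S]; split; last exact/GE.
split=> // g gG; have gS := Gamma_SL2 gG; rewrite le_phi1_mobius //.
have [c0|c0] := eqVneq (g 1 0) 0.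
  have [_ [_ [_ [_ [_ [_ _ _ _ d1]]]]]] := Gamma_c0 gG c0.
  by rewrite /jac c0 mul0r add0r d1 lerDl mulr_ge0 ?nsq_ge0 ?sqr_ge0.
by have [] := jac_bound gG c0 T; lra.
Qed.

Lemma triangleP (R : realType) (p : R * R) :
  triangle (1, 0) (2, 0) (1, 1) p <-> in_tri p.1 p.2.
Proof.
case: p => x y; split=> /=.
  by move=> [a [b [c [[a0 b0 c0] abc [-> ->]]]]] /=; rewrite /GRing.scale /=; split; lra.
move=> [h1 h2 h3]; exists (2 - x - y), (x - 1), y; split; first by split; lra.
- by ring.
- rewrite [RHS]surjective_pairing /=; congr pair.
    change (x = (2 - x - y) * 1 + (x - 1) * 2 + y * 1); ring.
  change (y = (2 - x - y) * 0 + (x - 1) * 0 + y * 1); ring.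
Qed.

(** * The axioms *)

(** Up to sign, w is a square root of half the Gaussian integer 2 w^2, which has bounded
    coordinates; [f] lists both roots over a grid shifted by N. *)
Lemma gauss_finite (R : realType) (K : R) :
  finite_set [set w : R[i] | nsq w <= K /\ gaussian_int (2 * w ^+ 2)].
Proof.
have [N hN] : exists N : nat, 4 * K ^+ 2 <= N%:R.
  by exists (Num.bound (4 * K ^+ 2)); apply/ltW/archi_boundP; rewrite mulr_ge0 ?sqr_ge0.
pose f (x : 'I_(2 * N).+1 * 'I_(2 * N).+1 * bool) : R[i] :=
  let r := sqrtc (gint R (x.1.1%:Z - N%:Z) (x.1.2%:Z - N%:Z) / 2) in
  if x.2 then r else - r.
apply: (@sub_finite_set _ _ (f @` setT)); last exact/finite_image/finite_finset.
move=> w [wK [m [n mn]]].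
rewrite -/(gint R m n) in mn.
have hmn : (m * m + n * n)%:~R <= (N%:Z)%:~R :> R.
  rewrite -nsq_gint -mn nsqM (_ : nsq 2 = 4); last by rewrite /nsq /=; ring.
  apply: le_trans hN; rewrite ler_pM2l // expr2 nsqM -expr2.
  by rewrite ler_sqr ?nnegrE ?(le_trans (nsq_ge0 w)) // nsq_ge0.
rewrite ler_int in hmn.
have hm : -N%:Z <= m <= N%:Z by apply/andP; split; nia.
have hn : -N%:Z <= n <= N%:Z by apply/andP; split; nia.
have [i hi] : exists i : 'I_(2 * N).+1, i%:Z - N%:Z = m.
  have h : (`|(m + N%:Z)%R|%N < (2 * N).+1)%N by lia.
  by exists (Ordinal h) => /=; lia.
have [j hj] : exists i : 'I_(2 * N).+1, i%:Z - N%:Z = n.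
  have h : (`|(n + N%:Z)%R|%N < (2 * N).+1)%N by lia.
  by exists (Ordinal h) => /=; lia.
have : w ^+ 2 == sqrtc (gint R m n / 2) ^+ 2.
  by rewrite sqr_sqrtc -mn mulrC mulKf // pnatr_eq0.
rewrite eqf_sqr => /orP[] /eqP ->.
- by exists (i, j, true); rewrite // /f /= hi hj.
- by exists (i, j, false); rewrite // /f /= hi hj.
Qed.

(** Applied with [r] the bottom row, on which both the coset and [jac] depend. *)
Lemma finite_image_factor (T U V : Type) (S : set T) (r : T -> U) (F : T -> V) :
  finite_set (r @` S) ->
  (forall x y, S x -> S y -> r x = r y -> F x = F y) -> finite_set (F @` S).
Proof.
move=> fin h; have [->|/set0P[x0 Sx0]] := eqVneq S set0; first by rewrite image_set0.
(* [F x0] is a mere default for values outside the image of [r]. *)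
pose G u := if pselect (exists2 x, S x & r x = u) is left h then F (projT1 (cid2 h)) else F x0.
apply: (@sub_finite_set _ _ (G @` (r @` S))); last exact: finite_image.
move=> _ [x Sx <-]; exists (r x); first by exists x.
rewrite /G; case: pselect => [e|[]]; last by exists x.
by case: cid2 => /= y Sy rxy; exact: h.
Qed.

Lemma jac_phi_inv (R : realType) (g : 'M[R[i]]_2) (p : 'rV[R]_3) :
  jac g (phi_inv p) = nsq (g 1 0 * (p 0 1 +i* p 0 2) + g 1 1) +
    nsq (g 1 0) * expR (- p 0 0) ^+ 2.
Proof.
rewrite /jac /zx /phi_inv.
by have [-> -> ->] := row3K (p 0 1) (p 0 2) (expR (- p 0 0)).
Qed.

Lemma Delta1E (R : realType) (g : 'M[R[i]]_2) (p : 'rV[R]_3) : SL2 g ->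
  Delta1 g p = - ln (jac g (phi_inv p)).
Proof.
move=> gS; have [z0 _] := phi_invK p; have J0 := jac_gt0 gS z0.
rewrite /Delta1 /phi1; have [_ ->] := mobiusE (phi_inv p) gS.
rewrite ln_div ?posrE //.
by ring.
Qed.

(** Decreasing phi_1 raises the point. Since [Delta1] is -ln [jac] and |c|^2 y^2 grows with y, the
    derivative is negative for every c != 0: this one direction serves both (A2) and (A4). *)
Lemma Delta1_down (R : realType) (g : 'M[R[i]]_2) (p : 'rV[R]_3) : SL2 g ->
  g 1 0 != 0 ->
  derivable (Delta1 g) p (row3 (-1) 0 0) /\
  'D_(row3 (-1) 0 0) (Delta1 g) p < 0.
Proof.
move=> gS c0; set u := row3 _ _ _.
pose C := nsq (g 1 0 * (p 0 1 +i* p 0 2) + g 1 1).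
pose k := nsq (g 1 0).
have k0 : 0 < k by rewrite lt_neqAle nsq_ge0 eq_sym nsq_eq0 c0.
have C0 : 0 <= C := nsq_ge0 _.
pose f (h : R) := - ln (C + k * expR (h - p 0 0) ^+ 2).
have E (h : R) : Delta1 g (h *: u + p) = f h.
  rewrite Delta1E // jac_phi_inv !mxE /= /f !mulr0 !add0r mulrN1 opprD opprK.
  by [].
pose X := C + k * expR (0 - p 0 0) ^+ 2.
have e0 : 0 < expR (0 - p 0 0) ^+ 2 by rewrite exprn_gt0 ?expR_gt0.
have pos : 0 < X by apply: ltr_wpDl => //; rewrite mulr_gt0.
have D : is_derive (0 : R) 1 f (- (X^-1 * (2 * k * expR (0 - p 0 0) ^+ 2))).
  apply: is_derN; apply: is_der_ln => //.
  apply: is_der_eq; rewrite /GRing.scale /=; ring.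
have E' : (fun h : R => Delta1 g (h *: u + p)) = f by apply/funext => h; exact: E.
split.
  by have := (@derivable1P _ _ _ (Delta1 g) p u).2; rewrite E'; apply; case: D.
have -> : 'D_u (Delta1 g) p = 'D_1 f 0.
  rewrite /derive (_ : (fun h : R => h^-1 *: _) =
      fun h : R => h^-1 *: ((f \o shift 0) (h *: 1) - f 0)) //.
  apply/funext => h /=.
  by rewrite -!E [h *: 1]mulr1 addr0 scale0r add0r.
rewrite (@derive_val _ _ _ _ _ _ _ D) oppr_lt0; apply: mulr_gt0.
  by rewrite invr_gt0.
by apply: mulr_gt0 => //; apply: mulr_gt0.
Qed.

(** Needed for (A2) because [critical_point] also counts points of non-differentiability. *)
Lemma Delta1_diff (R : realType) (g : 'M[R[i]]_2) (p : 'rV[R]_3) : SL2 g ->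
  differentiable (Delta1 g) p.
Proof.
move=> gS; have [z0 _] := phi_invK p; have := jac_gt0 gS z0.
rewrite jac_phi_inv => J0.
pose N (p : 'rV[R]_3) := nsq (g 1 0 * (p 0 1 +i* p 0 2) + g 1 1) +
    nsq (g 1 0) * expR (- p 0 0) ^+ 2.
have -> : Delta1 g = (fun p => - ln (N p)).
  by apply/funext => q; rewrite Delta1E // jac_phi_inv.
have dln : differentiable (fun x : R => - ln x) (N p).
  apply/derivable1_diffP.
  by case: (is_derN (@is_der_ln R (fun t => t) (N p) 1 J0 (is_der_id _))).
apply: (@differentiable_comp _ _ _ _ N (fun x => - ln x)) => //.
have dc i : differentiable (fun q : 'rV[R]_3 => q 0 i : R) p.
  exact: differentiable_coord.
have de : differentiable (fun q : 'rV[R]_3 => expR (- q 0 0)) p.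
  apply: (@differentiable_comp _ _ _ _ (fun q : 'rV[R]_3 => q 0 0) (fun x => expR (- x))) => //.
  apply/derivable1_diffP.
  by case: (is_der_exp (is_derN (is_der_id (p 0 0)))).
rewrite /N; case: (g 1 0) (g 1 1) => [c1 c2] [d1 d2]; rewrite /nsq /=.
have dcst (r : R) : differentiable (fun=> r : R) p by exact: differentiable_cst.
have dD (f h : 'rV[R]_3 -> R) : differentiable f p -> differentiable h p ->
  differentiable (fun q => f q + h q) p by exact: differentiableD.
have dM (f h : 'rV[R]_3 -> R) : differentiable f p -> differentiable h p ->
  differentiable (fun q => f q * h q) p by exact: differentiableM.
have dN (f : 'rV[R]_3 -> R) : differentiable f p ->
  differentiable (fun q => - f q) p by exact: differentiableN.
have dX (f : 'rV[R]_3 -> R) : differentiable f p ->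
  differentiable (fun q => f q ^+ 2) p by move=> df; exact: dM.
by repeat first [exact: dc | exact: de | exact: dcst | apply: (dX) | apply: (dN) |
  apply: (dD) | apply: (dM)].
Qed.

Lemma nstab1_c0 (R : realType) (g : 'M[R[i]]_2) :
  (@Gamma R `\` stab1 (@Gamma R)) g -> SL2 g /\ g 1 0 != 0.
Proof.
move=> [gG ns]; split; first exact: Gamma_SL2.
by apply/eqP => c0; apply: ns; exact/stab1P.
Qed.

Lemma Gamma_A2 (R : realType) : axiomA2 (@Gamma R).
Proof.
move=> g /nstab1_c0 [gS c0] p _ [|/(_ (row3 (-1) 0 0))].
  by apply; exact: Delta1_diff.
have [_] := Delta1_down p gS c0.
by rewrite deriveE; [move=> + E; rewrite E ltxx | exact: Delta1_diff].
Qed.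

Lemma Gamma_A4 (R : realType) : axiomA4 (@Gamma R).
Proof.
move=> z z0; exists (row3 (-1) 0 0).
  apply/eqP => /(congr1 (@x1 R)); have [-> _ _] := row3K (-1 : R) 0 0.
  by rewrite /x1 mxE => /eqP; rewrite oppr_eq0 oner_eq0.
by move=> g /nstab1_c0 [gS c0]; exact: Delta1_down.
Qed.

Lemma Gamma_A1 (R : realType) : axiomA1 (@Gamma R).
Proof.
have zxE2 (z w : 'rV[R]_3) : phi2 z = phi2 w -> phi3 z = phi3 w -> zx z = zx w.
  by rewrite /phi2 /phi3 /zx => -> ->.
split.
  move=> g /stab1P [gG c0] z w _ _ h2 h3; rewrite /phi2 -![x1 _]/(re (zx _)).
  by rewrite !(mobius_c0 _ gG c0).1 (zxE2 _ _ h2 h3).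
move=> g [gG h12] z w _ _ h3.
have [_ c0] : Gamma g /\ g 1 0 = 0.
  by apply/stab1P; split=> // v v0; have [] := h12 v v0.
have [e [e' [t [t' [k [_ _ Ea Et _]]]]]] := Gamma_c0 gG c0.
have E (x y : R) : re (gint R e e' * (x +i* y) + gint R t t') = x.
  have v0 : H3 (row3 x y 1) by rewrite /H3 /= /ht mxE.
  have [_] := h12 _ v0; rewrite /phi2 -![x1 (mobius _ _)]/(re (zx _)).
  rewrite (mobius_c0 _ gG c0).1 Ea Et /zx.
  by have [-> -> _] := row3K x y 1.
(* Preserving x_1 at the points 0, i and 1 leaves only the translations x |-> x + i t'. *)
have := E 0 0; have := E 0 1; have := E 1 0 => /=.
rewrite /= !(mulr0, mulr1, subr0, add0r, sub0r, addr0) => h1 h2 h0.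
have e1 : e%:~R = 1 :> R by lra.
have e0 : e'%:~R = 0 :> R by lra.
rewrite /phi3 -![x2 (mobius _ _)]/(im (zx _)) !(mobius_c0 _ gG c0).1 Ea Et /gint e1 e0 /=.
by rewrite !(mul1r, mul0r, mulr0, mulr1, addr0, add0r) -/(phi3 z) h3.
Qed.

Definition row_of (R : realType) (g : 'M[R[i]]_2) : R[i] * R[i] := (g 1 0, g 1 1).

Lemma nsq_subr (R : realType) (u v : R[i]) : nsq (u - v) <= 2 * nsq u + 2 * nsq v.
Proof.
case: u v => [a b] [c d]; rewrite /nsq /= -subr_ge0.
rewrite [leRHS](_ : _ = (a + c) ^+ 2 + (b + d) ^+ 2); last by ring.
by rewrite addr_ge0 ?sqr_ge0.
Qed.

(** The bound on [jac] bounds |c| because the height is at least y0, and then bounds |d| through d =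
    (c x + d) - c x; [gauss_finite] applies to both entries. *)
Lemma rows_finite (R : realType) (M y0 K : R) : 0 < y0 ->
  finite_set (@row_of R @` [set g | Gamma g /\ exists w,
    [/\ y0 <= ht w, nsq (zx w) <= M & jac g w <= K]]).
Proof.
move=> y00; pose K1 := K / y0 ^+ 2; pose K2 := 2 * K + 2 * (K1 * M).
apply: (@sub_finite_set _ _
  ([set w | nsq w <= K1 /\ gaussian_int (2 * w ^+ 2)] `*`
   [set w | nsq w <= K2 /\ gaussian_int (2 * w ^+ 2)])); last first.
  by apply: finite_setX; exact: gauss_finite.
move=> _ [g [gG [w [wy wM wK]]] <-].
have [e [e' [q [q' [f [f' [Ee _ Ef _]]]]]]] := Gamma_bottom_row gG.
have c1 : nsq (g 1 0) <= K1.
  rewrite ler_pdivlMr ?exprn_gt0 //; apply: le_trans wK; rewrite /jac.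
  rewrite -[leLHS]add0r lerD ?nsq_ge0 // ler_wpM2l ?nsq_ge0 //.
  by rewrite lerXn2r ?nnegrE // ltW // (lt_le_trans y00).
split; split=> /=; [exact: c1 | by exists e, e' | | by exists f, f'].
have -> : g 1 1 = (g 1 0 * zx w + g 1 1) - g 1 0 * zx w by ring.
apply: (le_trans (nsq_subr _ _)); rewrite /K2 lerD // ler_pM2l //.
  by apply: le_trans wK; rewrite /jac lerDl mulr_ge0 ?nsq_ge0 ?sqr_ge0.
by rewrite nsqM ler_pM ?nsq_ge0.
Qed.

(** When g and h share the bottom row (c, d), the product of g with the inverse of h has lower-left
    entry c d - d c = 0. *)
Lemma right_coset_sub (R : realType) (g h : 'M[R[i]]_2) :
  Gamma g -> Gamma h -> row_of g = row_of h ->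
  right_coset (stab1 (@Gamma R)) g `<=` right_coset (stab1 (@Gamma R)) h.
Proof.
move=> gG hG [c d] _ [s /stab1P [sG s0] <-].
have gS := Gamma_SL2 gG; have hS := Gamma_SL2 hG.
exists (s *m g *m invmx h); last first.
  by rewrite mulmxKV //; exact: SL2_unit.
apply/stab1P; split; first by apply: GammaM; [exact: GammaM | exact: GammaV].
rewrite (invmx2 hS) !mul2E s0 c d !mx2E; ring.
Qed.

Lemma Gamma_A3 (R : realType) : axiomA3 (@Gamma R).
Proof.
move=> z B z0.
(* On [U] the condition phi_1 (g w) <= B becomes [jac g w] <= 2 y(z) e^B, a bound uniform in w. *)
pose U := [set w : 'rV[R]_3 | [/\ ht z / 2 < ht w, ht w < 2 * ht z &
   nsq (zx w) < nsq (zx z) + 1]].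
have ch : {for z, continuous (@ht R)} by exact: coord_continuous.
have c1 : {for z, continuous (@x1 R)} by exact: coord_continuous.
have c2 : {for z, continuous (@x2 R)} by exact: coord_continuous.
have cn : {for z, continuous (fun w : 'rV[R]_3 => nsq (zx w))}.
  by rewrite /nsq /zx /=; apply: continuousD; apply: continuousM.
have z0' : 0 < ht z := z0.
exists U; split.
- have n1 : \forall w \near z, ht z / 2 < ht w by apply: (cvgr_gt _ ch); lra.
  have n2 : \forall w \near z, ht w < 2 * ht z by apply: (cvgr_lt _ ch); lra.
  have n3 : \forall w \near z, nsq (zx w) < nsq (zx z) + 1.
    by apply: (cvgr_lt _ cn); lra.
  by apply: filterS (filterI n1 (filterI n2 n3)) => w [? []].
- by move=> w [h _ _]; rewrite /H3 /=; apply: lt_trans h; rewrite divr_gt0.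
apply: (finite_image_factor (r := @row_of R)); last first.
  move=> g h [gG _] [hG _] E.
  by apply/seteqP; split; exact: right_coset_sub.
apply: sub_finite_set (rows_finite (nsq (zx z) + 1) (2 * ht z * expR B)
  (divr_gt0 z0' (ltr0n R 2))).
apply: image_subset => g [gG [w [w1 w2 w3] wB]]; split=> //; exists w.
have w0 : H3 w by rewrite /H3 /=; apply: lt_trans w1; rewrite divr_gt0.
split; [exact: ltW | exact: ltW |].
have gS := Gamma_SL2 gG; move: wB; rewrite /phi1; have [_ ->] := mobiusE w gS.
have J0 := jac_gt0 gS w0.
have X0 : 0 < ht w / jac g w by rewrite divr_gt0.
move=> h; have {}h : - B <= ln (ht w / jac g w) by rewrite lerNl.
have : expR (- B) <= expR (ln (ht w / jac g w)) by rewrite ler_expR.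
rewrite lnK // expRN ler_pdivlMr // mulrC.
rewrite ler_pdivrMr ?expR_gt0 // => h'.
by apply: (le_trans h'); rewrite ler_pM2r ?expR_gt0 // ltW.
Qed.

(** * The triangle tiles the plane *)

(** Each unit square of the integer grid is cut along a diagonal whose direction depends on the
    parity of n + m. The four kinds of half-squares are brought to the triangle by the four
    units. *)
Lemma tri_cover (R : realType) (x y : R) : exists e e' t t' k : int,
  [/\ e * e + e' * e' = 1, t + t' = 2 * k &
  in_tri (e%:~R * x - e'%:~R * y + t%:~R) (e%:~R * y + e'%:~R * x + t'%:~R)].
Proof.
set n := Num.floor (x - 1); set m := Num.floor y.
have /andP[n0 n1] := real_floor_itv (num_real (x - 1)).
have /andP[m0 m1] := real_floor_itv (num_real y).
rewrite -/n -/m in n0 n1 m0 m1; rewrite !intrD in n1 m1.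
have [k [nm|nm]] : exists k, n + m = 2 * k \/ n + m = 2 * k + 1.
  by exists ((n + m) %/ 2)%Z; lia.
- have [s|s] := lerP (x - 1 - n%:~R + (y - m%:~R)) 1.
    exists 1, 0, (- n), (- m), (- k); split; [lia | lia |].
    by rewrite !mulrNz; split; lra.
  exists (-1), 0, (3 + n), (1 + m), (2 + k); split; [lia | lia |].
  by rewrite !intrD !mulrNz; split; lra.
- have [s|s] := lerP (1 - (y - m%:~R) + (x - 1 - n%:~R)) 1.
    exists 0, 1, (2 + m), (- 1 - n), (m - k); split; [lia | lia |].
    by rewrite !intrD !mulrNz; split; lra.
  exists 0, (-1), (1 - m), (2 + n), (n - k + 1); split; [lia | lia |].
  by rewrite !intrD !mulrNz; split; lra.
Qed.

(** For the half-turn the bounds on t and t' have no integer solution; for each quarter-turn they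
    leave a single pair, whose sum is odd. *)
Lemma tri_rigid (R : realType) (e e' t t' k : int) (x y : R) :
  e * e + e' * e' = 1 -> t + t' = 2 * k ->
  1 < x -> 0 < y -> x + y < 2 ->
  in_tri (e%:~R * x - e'%:~R * y + t%:~R) (e%:~R * y + e'%:~R * x + t'%:~R) ->
  [/\ e = 1, e' = 0, t = 0 & t' = 0].
Proof.
move=> he ht hx hy hxy [].
have h1 : e = -1 \/ e = 0 \/ e = 1 by nia.
have h2 : e' = -1 \/ e' = 0 \/ e' = 1 by nia.
have I (a b : int) : a%:~R < b%:~R :> R -> a < b by rewrite ltr_int.
case: h1 => [?|[?|?]]; case: h2 => [?|[?|?]]; subst e e' => //;
  rewrite ?mulrNz => A1 A2 A3.
- have a1 : 2 < t by apply: I; lra.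
  have a2 : 0 < t' by apply: I; lra.
  have a3 : t + t' < 4 by apply: I; rewrite intrD; lra.
  by lia.
- have a1 : 0 < t by apply: I; lra.
  have a2 : t < 2 by apply: I; lra.
  have a3 : 1 < t' by apply: I; lra.
  have a4 : t' < 3 by apply: I; lra.
  by lia.
- have a1 : 1 < t by apply: I; lra.
  have a2 : t < 3 by apply: I; lra.
  have a3 : -2 < t' by apply: I; rewrite mulrNz; lra.
  have a4 : t' < 0 by apply: I; lra.
  by lia.
- have a1 : -1 < t by apply: I; rewrite mulrNz; lra.
  have a2 : t < 1 by apply: I; lra.
  have a3 : -1 < t' by apply: I; rewrite mulrNz; lra.
  have a4 : t' < 1 by apply: I; lra.
  by split; lia.
Qed.

(** * Fundamental domains *)

(** A small move in a chosen direction stays in [F]; this turns interior position into strict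
    inequalities. *)
Lemma nbhs_ray01 (R : realType) (V : normedModType R) (z v : V) (F : set V) :
  nbhs z F -> exists2 t : R, 0 < t < 1 & F (t *: v + z).
Proof.
move=> zF; have c : {for (0 : R), continuous (fun t : R => t *: v + z)}.
  by apply: continuousD; [apply: continuousZl; exact: cvg_id | exact: cst_continuous].
have : nbhs (0 : R) ((fun t : R => t *: v + z) @^-1` F).
  by apply: c; rewrite scale0r add0r.
move=> /nbhs_ballP[e /= e0 h].
have m0 : 0 < Num.min e 1 by rewrite lt_min e0 ltr01.
exists (Num.min e 1 / 2).
  by rewrite divr_gt0 //= ltr_pdivrMr // mul1r gt_min ltr1n orbT.
apply: h; rewrite /ball /= sub0r normrN gtr0_norm ?divr_gt0 //.
by rewrite ltr_pdivrMr // gt_min ltr_pMr // ltr1n.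
Qed.

Lemma nbhs_ray (R : realType) (V : normedModType R) (z v : V) (F : set V) :
  nbhs z F -> exists2 t : R, 0 < t & F (t *: v + z).
Proof. by move=> /(nbhs_ray01 v)[t /andP[t0 _]]; exists t. Qed.

(** Around a point interior to [X], the subspace topology has the same neighbourhoods as the ambient
    one. *)
Lemma boundary_inP (T : topologicalType) (X F : set T) (z : T) :
  nbhs z X -> F z -> ~ nbhs z F -> boundary_in X F z.
Proof.
move=> zX Fz nF; split; first exact: subset_closure.
move=> h; apply: nF.
have : within X (nbhs z) F.
  by rewrite nbhs_subspace_in; [exact: h | exact: nbhs_singleton].
by rewrite /within /= => h'; apply: filterS (filterI h' zX) => x [] /[apply].
Qed.

Lemma finite_min (R : realType) (T : Type) (S : set T) (F : T -> R) (x0 : T) :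
  S x0 -> finite_set (F @` S) ->
  exists2 x, S x & forall y, S y -> F x <= F y.
Proof.
move=> Sx0 /finite_seqP[s sE].
have smin (r : seq R) a : a \in r -> exists2 m, m \in r & forall b, b \in r -> m <= b.
  elim: r a => // b r IH a _; case: r IH => [|c r] IH.
    by exists b; rewrite ?mem_head // => x; rewrite inE => /eqP ->.
  have [m mr hm] := IH c (mem_head _ _).
  have [bm|mb] := lerP b m.
    exists b; first exact: mem_head.
    move=> x; rewrite in_cons => /orP[/eqP ->//|/hm]; exact: le_trans.
  exists m; first by rewrite in_cons mr orbT.
  by move=> x; rewrite in_cons => /orP[/eqP ->|/hm//]; exact: ltW.
have mem y : S y -> F y \in s.
  by move=> Sy; have : (F @` S) (F y) by [exists y]; rewrite sE.
have [m ms hm] := smin _ _ (mem _ Sx0).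
have : (F @` S) m by rewrite sE.
by move=> [x Sx xm]; exists x => // y /mem /hm; rewrite xm.
Qed.

(** Every orbit has a highest point: the competitors with [jac] at most 1, among them the identity,
    have finitely many bottom rows. *)
Lemma jac_min (R : realType) (z : 'rV[R]_3) : H3 z ->
  exists2 g, Gamma g & forall h, Gamma h -> jac g z <= jac h z.
Proof.
move=> z0; pose S : set 'M[R[i]]_2 := [set g | Gamma g /\ jac g z <= 1].
have J1 : jac 1%:M z = 1.
  rewrite /jac !mxE /= nsq0 !mul0r addr0 add0r /nsq /=; ring.
have S1 : S 1%:M by split; [exact: Gamma1 | rewrite J1].
have fin : finite_set ((fun g => jac g z) @` S).
  apply: (finite_image_factor (r := @row_of R)).
    apply: sub_finite_set (rows_finite (nsq (zx z)) 1 z0).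
    by apply: image_subset => g [gG g1]; split=> //; exists z.
  by move=> g h _ _ [c d]; rewrite /jac c d.
have [g [gG g1] hg] := finite_min S1 fin.
exists g => // h hG; have [h1|h1] := lerP (jac h z) 1; first by apply: hg.
by apply: le_trans (ltW h1).
Qed.

Lemma c0_eq_pm (R : realType) (h : 'M[R[i]]_2) (z : 'rV[R]_3) :
  Gamma h -> h 1 0 = 0 -> H3 z -> 1 < x1 z -> 0 < x2 z -> x1 z + x2 z < 2 ->
  in_tri (x1 (mobius h z)) (x2 (mobius h z)) -> eq_pm h 1%:M.
Proof.
move=> hG c0 z0 hx hy hxy.
have [e [e' [t [t' [k [he ht Ea Et _]]]]]] := Gamma_c0 hG c0.
have := (mobius_c0 z hG c0).1; rewrite Ea Et {1}/zx => -[-> ->] T.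
have [] := tri_rigid he ht hx hy hxy.
  by case: T => /= *; split; lra.
move=> e1 e0 t0 t'0; subst e e' t t'.
have a2 : h 0 0 ^+ 2 == 1 ^+ 2 by rewrite Ea expr1n.
have a0 : h 0 0 != 0 by apply/eqP => a0; move: a2; rewrite a0 expr0n expr1n eq_sym oner_eq0.
have b0 : h 0 1 = 0.
  by move/eqP: Et; rewrite -[gint R 0 0]/(0 : R[i]) mulf_eq0 (negbTE a0) => /eqP.
have : h 0 0 * h 1 1 = 1.
  by have := Gamma_SL2 hG; rewrite /SL2 /= det2E c0 mulr0 subr0.
have one2 : (1%:M : 'M[R[i]]_2) = mx2 1 0 0 1.
  by apply: matrix2P; rewrite mx2E mxE.
move: a2; rewrite eqf_sqr one2 => /orP[] /eqP aE; rewrite aE => dE; [left|right].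
  by apply: matrix2P; rewrite mx2E // -dE mul1r.
apply: matrix2P; rewrite [in RHS]mxE mx2E ?oppr0 //.
by rewrite -dE mulN1r opprK.
Qed.

Lemma eq_pm_divl (R : realType) (g1 g2 : 'M[R[i]]_2) :
  SL2 g2 -> eq_pm (invmx g2 *m g1) 1%:M -> eq_pm g1 g2.
Proof.
move=> /SL2_unit u [] /(congr1 (mulmx g2)); rewrite mulKVmx // ?mulmxN mulmx1 => ->;
  by [left | right].
Qed.

Lemma eq_pm_sym (R : realType) (g1 g2 : 'M[R[i]]_2) : eq_pm g1 g2 -> eq_pm g2 g1.
Proof. by move=> [->|->]; [left | right; rewrite opprK]. Qed.

Lemma tri_nbhs (R : realType) (G : set (R * R)) (p : R * R) :
  (forall p, G p -> in_tri p.1 p.2) -> nbhs p G ->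
  [/\ 1 < p.1, 0 < p.2 & p.1 + p.2 < 2].
Proof.
case: p => x y GT pG /=.
have ray v1 v2 : exists2 s : R, 0 < s & in_tri (s * v1 + x) (s * v2 + y).
  by have [s s0 /GT] := nbhs_ray (v1, v2) pG; exists s.
split.
- by have [s s0 []] := ray (-1) 0; lra.
- by have [s s0 []] := ray 0 (-1); lra.
- by have [s s0 []] := ray 1 0; lra.
Qed.

Lemma row3_pair_inj (R : realType) (p q : R * R) :
  row3 p.1 p.2 1 = row3 q.1 q.2 1 -> p = q.
Proof.
case: p q => [a b] [c d] /= E.
have := congr1 (@x1 R) E; have := congr1 (@x2 R) E.
by rewrite /x1 /x2 !mxE /= => -> ->.
Qed.

Lemma fundamental_domain_C (R : realType) (G : set (R * R)) :
  (forall p, G p <-> in_tri p.1 p.2) ->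
  fundamental_domain setT (stab1 (@Gamma R)) (@eq_pm R) (@mobius_C R) G.
Proof.
move=> GT.
have h1 (p : R * R) : H3 (row3 p.1 p.2 1) by rewrite /H3 /= /ht mxE.
have mE g p : stab1 (@Gamma R) g -> mobius g (row3 p.1 p.2 1) =
    row3 (mobius_C g p).1 (mobius_C g p).2 1.
  move=> /stab1P[gG c0]; rewrite [LHS]row3E /mobius_C /xpart /=.
  by rewrite (mobius_c0 _ gG c0).2; have [_ _ ->] := row3K p.1 p.2 1.
split=> //.
  apply/seteqP; split=> // p _.
  have [e [e' [t [t' [k [he ht T]]]]]] := tri_cover p.1 p.2.
  have [g [gG c0 Ea Et]] := stab_ex R he ht.
  have gs : stab1 (@Gamma R) g by apply/stab1P.
  have gV : stab1 (@Gamma R) (invmx g).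
    apply/stab1P; split; first exact: GammaV.
    by rewrite invmx2 ?mx2E ?c0 ?oppr0 //; exact: Gamma_SL2.
  exists (invmx g) => //; exists (mobius_C g p).
    have := (mobius_c0 (row3 p.1 p.2 1) gG c0).1.
    rewrite Ea Et /zx; have [-> -> _] := row3K p.1 p.2 1 => -[E1 E2].
    by apply/GT; rewrite /mobius_C /xpart /= E1 E2 /=; case: T => *; split; lra.
  have := mobiusK (Gamma_SL2 gG) (h1 p); rewrite mE // mE // => E.
  exact: row3_pair_inj E.
(* Contrapositive of the boundary condition: an overlap at an interior point of [G] forces equality
   up to sign. *)
have core g1 g2 f1 f2 : stab1 (@Gamma R) g1 -> stab1 (@Gamma R) g2 ->
    mobius_C g1 f1 = mobius_C g2 f2 -> G f2 -> nbhs f1 G -> eq_pm g1 g2.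
  move=> s1 s2 E /GT T2 /(tri_nbhs (fun p => (GT p).1)) [t1 t2 t3].
  have [G1 c1] := (stab1P g1).1 s1; have [G2 c2] := (stab1P g2).1 s2.
  have S1 := Gamma_SL2 G1; have S2 := Gamma_SL2 G2.
  apply: (eq_pm_divl S2).
  have [e1 e2 _] := row3K f1.1 f1.2 1.
  apply: (c0_eq_pm (z := row3 f1.1 f1.2 1)); rewrite ?e1 ?e2 //.
  - by apply: GammaM => //; exact: GammaV.
  - by rewrite invmx2 // mul2E !mx2E c1 c2; ring.
  - rewrite (mobiusM (SL2V S2) S1 (h1 _)) mE // E -mE // (mobiusK S2 (h1 _)).
    by have [-> -> _] := row3K f2.1 f2.2 1.
have bd g1 g2 : stab1 (@Gamma R) g1 -> stab1 (@Gamma R) g2 -> ~ eq_pm g1 g2 ->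
    mobius_C g1 @` G `&` mobius_C g2 @` G `<=` mobius_C g1 @` boundary_in setT G.
  move=> s1 s2 ne _ [[f1 Gf1 <-] [f2 Gf2 E]]; exists f1 => //.
  apply: boundary_inP => //; first exact: filterT.
  by move=> n1; apply: ne; exact: (core _ _ _ _ s1 s2 (esym E) Gf2).
move=> g1 g2 s1 s2 ne; split; first exact: bd.
by rewrite setIC; apply: bd => // /eq_pm_sym.
Qed.

Lemma fundamental_domain_H3 (R : realType) (G : set (R * R)) :
  (forall p, G p <-> in_tri p.1 p.2) ->
  fundamental_domain (@H3 R) (@Gamma R) (@eq_pm R) (@mobius R)
    (grenier (@Gamma R) G).
Proof.
move=> GT; have FE := grenier_triE GT.
have H3o (z : 'rV[R]_3) : H3 z -> nbhs z (@H3 R).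
  move=> z0; have ch : {for z, continuous (@ht R)} by exact: coord_continuous.
  by apply: (cvgr_gt _ ch).
split.
- by move=> z [[]].
- apply/seteqP; split=> z; last first.
    by move=> [g gG [w [[w0 _] _] <-]]; exact: (mobius_H3 (Gamma_SL2 gG)).
  move=> z0; have [g gG gmin] := jac_min z0.
  have gS := Gamma_SL2 gG; have gz0 := mobius_H3 gS z0.
  (* The highest point of the orbit is moved above the triangle by the stabilizer, which keeps its
     height. *)
  have [e [e' [t [t' [k [he ht T]]]]]] := tri_cover (x1 (mobius g z)) (x2 (mobius g z)).
  have [s [sG c0 Ea Et]] := stab_ex R he ht.
  have sS := Gamma_SL2 sG.
  have sgS := SL2M sS gS; have sgG := GammaM sG gG.
  exists (invmx (s *m g)); first exact: GammaV.
  exists (mobius (s *m g) z); last exact: mobiusK.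
  rewrite (mobiusM sS gS z0).
  have [E1 E2] := mobius_c0 (mobius g z) sG c0.
  split; last first.
    apply/GT; rewrite /xpart /=; move: E1; rewrite Ea Et /zx => -[-> ->] /=.
    by case: T => *; split; lra.
  split; first exact: mobius_H3.
  move=> h hG; rewrite -(mobiusM (Gamma_SL2 hG) sS gz0).
  have hsG := GammaM hG sG; have hsS := Gamma_SL2 hsG.
  rewrite le_phi1; [|exact: mobius_H3|exact: mobius_H3].
  rewrite E2 -(mobiusM hsS gS z0).
  rewrite (mobiusE z (SL2M hsS gS)).2 (mobiusE z gS).2.
  rewrite ler_pM2l //; rewrite lef_pV2 ?posrE ?jac_gt0 //; last exact: SL2M.
  by apply: gmin; exact: GammaM.
have core g1 g2 f1 f2 : Gamma g1 -> Gamma g2 ->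
    mobius g1 f1 = mobius g2 f2 -> grenier (@Gamma R) G f1 ->
    grenier (@Gamma R) G f2 -> nbhs f1 (grenier (@Gamma R) G) -> eq_pm g1 g2.
  move=> G1 G2 E F1 F2 nF; have S1 := Gamma_SL2 G1; have S2 := Gamma_SL2 G2.
  have f10 : H3 f1 by case: F1 => -[].
  have f20 : H3 f2 by case: F2 => -[].
  have hG := GammaM (GammaV G2) G1; have hS := Gamma_SL2 hG.
  have hE : mobius (invmx g2 *m g1) f1 = f2.
    by rewrite (mobiusM (SL2V S2) S1 f10) E (mobiusK S2 f20).
  have ray v1 v2 v3 : exists2 s : R, 0 < s &
     [/\ 0 < s * v3 + ht f1, in_tri (s * v1 + x1 f1) (s * v2 + x2 f1) &
      2 <= (s * v1 + x1 f1 - 1) ^+ 2 + (s * v2 + x2 f1) ^+ 2 + (s * v3 + ht f1) ^+ 2].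
    have [s s0] := nbhs_ray (row3 v1 v2 v3) nF; rewrite FE => -[].
    by rewrite /H3 /sph /ht /x1 /x2 /= !mxE /=; exists s.
  have h1 : 1 < x1 f1 by have [s s0 [_ [] ]] := ray (-1) 0 0; lra.
  have h2 : 0 < x2 f1 by have [s s0 [_ [] ]] := ray 0 (-1) 0; lra.
  have h3 : x1 f1 + x2 f1 < 2 by have [s s0 [_ [] ]] := ray 1 0 0; lra.
  have h4 : 2 < sph f1.
    have [s s0 [p1 _ p2]] := ray 0 0 (-1); rewrite /sph.
    by rewrite !mulr0 !add0r in p2; move: f10; rewrite /H3 /= => f10; nra.
  apply: (eq_pm_divl S2); apply: (c0_eq_pm hG _ f10 h1 h2 h3); last first.
    by rewrite hE; case: F2 => _ /GT.
  apply/eqP; apply: contraT => c0.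
  have T1 : in_tri (x1 f1) (x2 f1) by split; exact: ltW.
  (* As f2 is highest in its orbit, the element taking f1 to f2 does not lower f1; but c != 0 and
     [sph f1 > 2] would make [jac] exceed 1. *)
  have J : jac (invmx g2 *m g1) f1 <= 1.
    case: F2 => -[_ /(_ _ (GammaV hG))]; rewrite -{2}hE (mobiusK hS f10).
    rewrite le_phi1 // -hE (mobiusE _ hS).2 ler_pdivlMr ?jac_gt0 //.
    by rewrite ger_pMr.
  by have [] := jac_bound hG c0 T1; lra.
have bd g1 g2 : Gamma g1 -> Gamma g2 -> ~ eq_pm g1 g2 ->
    mobius g1 @` grenier (@Gamma R) G `&` mobius g2 @` grenier (@Gamma R) G
    `<=` mobius g1 @` boundary_in (@H3 R) (grenier (@Gamma R) G).
  move=> s1 s2 ne _ [[f1 Ff1 <-] [f2 Ff2 E]]; exists f1 => //.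
  apply: boundary_inP => //; first by apply: H3o; case: Ff1 => -[].
  by move=> n1; apply: ne; exact: (core _ _ _ _ s1 s2 (esym E) Ff1 Ff2).
move=> g1 g2 s1 s2 ne; split; first exact: bd.
by rewrite setIC; apply: bd => // /eq_pm_sym.
Qed.

Local Close Scope complex_scope.

Lemma closure_interior_tri (R : realType) (G : set (R * R)) :
  (forall p, G p <-> in_tri p.1 p.2) -> G = closure (interior G).
Proof.
move=> GT.
have cf p : {for p, continuous (fst : R * R -> R)} by exact: cvg_fst.
have cs p : {for p, continuous (snd : R * R -> R)} by exact: cvg_snd.
have ca p : {for p, continuous (fun q : R * R => q.1 + q.2)} by apply: cvgD; [exact: cf | exact: cs].
apply/seteqP; split=> p.
  move=> /GT [h1 h2 h3] B pB.
  (* (4/3, 1/3) is the centroid; moving towards it enters the interior at once. *)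
  have [t /andP[t0 t1] Bt] := nbhs_ray01 ((4 / 3, 1 / 3) - p) pB.
  exists (t *: ((4 / 3, 1 / 3) - p) + p); split=> //.
  set q := _ + p.
  have q1 : q.1 = t * (4 / 3 - p.1) + p.1 by [].
  have q2 : q.2 = t * (1 / 3 - p.2) + p.2 by [].
  have n1 : \forall r \near q, 1 < r.1 by apply: (cvgr_gt _ (cf q)); nra.
  have n2 : \forall r \near q, 0 < r.2 by apply: (cvgr_gt _ (cs q)); nra.
  have n3 : \forall r \near q, r.1 + r.2 < 2 by apply: (cvgr_lt _ (ca q)); nra.
  rewrite /interior /=.
  apply: filterS (filterI n1 (filterI n2 n3)) => r [r1 [r2 r3]].
  by apply/GT; split; exact: ltW.
move=> clp; apply/GT; split; rewrite leNgt; apply/negP => lt.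
- have /clp[q [/nbhs_singleton/GT[h _ _]]] : \forall r \near p, r.1 < 1 by apply: (cvgr_lt _ (cf p)).
  by rewrite /= ltNge h.
- have /clp[q [/nbhs_singleton/GT[_ h _]]] : \forall r \near p, r.2 < 0 by apply: (cvgr_lt _ (cs p)).
  by rewrite /= ltNge h.
- have /clp[q [/nbhs_singleton/GT[_ _ h]]] : \forall r \near p, 2 < r.1 + r.2 by apply: (cvgr_gt _ (ca p)).
  by rewrite /= ltNge h.
Qed.

(** * Christoffel symbols of the half-space metric *)

Lemma hyp_metric_deriv (R : realType) (z : 'rV[R]_3) (a b l : 'I_3) : H3 z ->
  'D_(delta_mx 0 a) (fun w => hyp_metric w b l) z =
  - 2 * (ht z) ^- 3 * (a == 2)%:R * (b == l)%:R.
Proof.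
move=> z0; have y0 : ht z != 0 by rewrite gt_eqF.
rewrite derive_line.
have [->|bl] := eqVneq b l; last first.
  rewrite (_ : (fun h : R => _) = cst 0); first by rewrite derive_cst mulr0.
  by apply/funext => h; rewrite mxE (negbTE bl) mulr0n.
rewrite (_ : (fun h : R => _) = fun h => ((h * (a == 2)%:R + ht z) * (h * (a == 2)%:R + ht z))^-1).
  have D : is_derive (0 : R) 1 (fun h => h * (a == 2)%:R + ht z) (a == 2)%:R.
    apply: is_der_eq (is_derD (is_derM (is_der_id _) (is_der_cst _ _)) (is_der_cst _ _)) _.
    by ring.
  have D2 := is_derM D D.
  have nz : (0 * (a == 2)%:R + ht z) * (0 * (a == 2)%:R + ht z) != 0.
    by rewrite mul0r add0r mulf_neq0.
  have D3 := is_derV (f := fun h => (h * (a == 2)%:R + ht z) * (h * (a == 2)%:R + ht z)) nz D2.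
  rewrite (@derive_val _ _ _ _ _ _ _ D3) /=.
  by rewrite !mul0r !add0r; field.
apply/funext => h; rewrite mxE eqxx mulr1n /ht !mxE /= eq_sym.
by rewrite expr2.
Qed.

Lemma christoffelE (R : realType) (z : 'rV[R]_3) (k i j : 'I_3) : H3 z ->
  christoffel (@hyp_metric R) z k i j =
  - (ht z)^-1 * ((i == 2)%:R * (j == k)%:R + (j == 2)%:R * (i == k)%:R -
                 (k == 2)%:R * (i == j)%:R).
Proof.
move=> z0; have y0 : ht z != 0 by rewrite gt_eqF.
rewrite /christoffel (bigD1 k) //= big1 ?addr0; last first.
  by move=> l lk; rewrite invmx_scalar mxE eq_sym (negbTE lk) mulr0n mul0r.
rewrite invmx_scalar mxE eqxx mulr1n !hyp_metric_deriv //.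
by field.
Qed.

Lemma christoffel_sum (R : realType) (z : 'rV[R]_3) (k : 'I_3) (v : 'I_3 -> R) :
  H3 z ->
  \sum_(i < 3) \sum_(j < 3) christoffel (@hyp_metric R) z k i j * v i * v j =
  - (ht z)^-1 * (2 * v 2 * v k -
     (k == 2)%:R * (v 0 * v 0 + v 1 * v 1 + v 2 * v 2)).
Proof.
move=> z0; have y0 : ht z != 0 by rewrite gt_eqF.
rewrite !sum3E !christoffelE //; move: k.
by apply: ord3P; rewrite /= ?(mulr0n, mulr1n); field.
Qed.

(** * The geodesic equation *)

Lemma is_derive_derive1 (R : realType) (f : R -> R) (t : R) :
  derivable f t 1 -> is_derive t 1 f (derive1 f t).
Proof. by move=> /derivableP; rewrite derive1E. Qed.

(* [x'], [y'], [h'] are the derivatives of the coordinates [x], [y] and of the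
   height [h]. *)
Definition geodesic_ode (R : realType) (x y h x' y' h' : R -> R) : Prop :=
  forall t : R, [/\ 0 < h t,
    [/\ is_derive t 1 x (x' t), is_derive t 1 y (y' t) & is_derive t 1 h (h' t)] &
    [/\ is_derive t 1 x' (2 * x' t * h' t / h t),
        is_derive t 1 y' (2 * y' t * h' t / h t) &
        is_derive t 1 h' ((h' t * h' t - x' t * x' t - y' t * y' t) / h t)]].

Lemma geodesic_lineP (R : realType) (c : R -> 'rV[R]_3) : geodesic_line c ->
  exists x' y' h' : R -> R,
    geodesic_ode (fun t => x1 (c t)) (fun t => x2 (c t)) (fun t => ht (c t)) x' y' h'.
Proof.
move=> g; pose ck (i : 'I_3) := fun s : R => c s 0 i.
exists (derive1 (ck 0)), (derive1 (ck 1)), (derive1 (ck 2)) => t.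
have [z0 gk] := g t; have y0 : ht (c t) != 0 by rewrite gt_eqF.
have d1 k : is_derive t 1 (ck k) (derive1 (ck k) t).
  by have [d _ _] := gk k; exact: is_derive_derive1.
have d2 k : is_derive t 1 (derive1 (ck k)) (derive1 (derive1 (ck k)) t).
  by have [_ d _] := gk k; exact: is_derive_derive1.
have d3 k : derive1 (derive1 (ck k)) t = (ht (c t))^-1 *
   (2 * derive1 (ck 2) t * derive1 (ck k) t - (k == 2)%:R *
    (derive1 (ck 0) t * derive1 (ck 0) t + derive1 (ck 1) t * derive1 (ck 1) t +
     derive1 (ck 2) t * derive1 (ck 2) t)).
  have [_ _] := gk k.
  rewrite (christoffel_sum k (fun i => derive1 (ck i) t) z0) mulNr.
  by move=> /eqP; rewrite subr_eq0 => /eqP.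
split; [exact: z0 | split; exact: d1 |].
split.
- by apply: (is_der_eq (d2 0)); rewrite d3 /= mulr0n; field.
- by apply: (is_der_eq (d2 1)); rewrite d3 /= mulr0n; field.
- by apply: (is_der_eq (d2 2)); rewrite d3 /= mulr1n; field.
Qed.

Lemma line_geodesic (R : realType) (x y h x' y' h' : R -> R) :
  geodesic_ode x y h x' y' h' -> geodesic_line (fun t => row3 (x t) (y t) (h t)).
Proof.
move=> g t; have [h0 _ _] := g t.
have z0 : H3 (row3 (x t) (y t) (h t)) by rewrite /H3 /= /ht mxE.
split=> // k.
pose F (i : 'I_3) : R -> R := nth x [:: x; y; h] i.
pose F' (i : 'I_3) : R -> R := nth x [:: x'; y'; h'] i.
have cE i : (fun s => row3 (x s) (y s) (h s) 0 i) = F i.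
  by apply/funext => s; rewrite mxE; move: i; apply: ord3P.
have dF (i : 'I_3) (s : R) : is_derive s 1 (F i) (F' i s).
  by have [_ [? ? ?] _] := g s; move: i; apply: ord3P.
have F1 i : derive1 (F i) = F' i.
  by apply/funext => s; rewrite derive1E (@derive_val _ _ _ _ _ _ _ (dF i s)).
have y0 : h t != 0 by rewrite gt_eqF.
have hE : ht (row3 (x t) (y t) (h t)) = h t by rewrite /ht mxE.
rewrite /= -/row3.
have -> : \sum_(i < 3) \sum_(j < 3) christoffel (@hyp_metric R) (row3 (x t) (y t) (h t)) k i j *
    derive1 (fun s => row3 (x s) (y s) (h s) 0 i) t *
    derive1 (fun s => row3 (x s) (y s) (h s) 0 j) t =
  - (h t)^-1 * (2 * F' 2 t * F' k t -
     (k == 2)%:R * (F' 0 t * F' 0 t + F' 1 t * F' 1 t + F' 2 t * F' 2 t)).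
  have := christoffel_sum k (fun i => F' i t) z0; rewrite hE => <-.
  by apply: eq_bigr => i _; apply: eq_bigr => j _; rewrite !cE !F1.
rewrite !cE !F1.
have [_ _ [d1 d2 d3]] := g t.
have dF' : derivable (F' k) t 1 /\ derive1 (F' k) t =
  (h t)^-1 * (2 * F' 2 t * F' k t -
     (k == 2)%:R * (F' 0 t * F' 0 t + F' 1 t * F' 1 t + F' 2 t * F' 2 t)).
  rewrite derive1E; move: k; apply: ord3P; rewrite /F' /= ?mulr0n ?mulr1n.
  - by split; [case: d1 | rewrite (@derive_val _ _ _ _ _ _ _ d1); field].
  - by split; [case: d2 | rewrite (@derive_val _ _ _ _ _ _ _ d2); field].
  - by split; [case: d3 | rewrite (@derive_val _ _ _ _ _ _ _ d3); field].
have [D1 D2] := dF'.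
split; [by case: (dF k t) | exact: D1 |].
by rewrite D2 mulNr subrr.
Qed.

Lemma der0_cst (R : realType) (f : R -> R) :
  (forall t : R, is_derive t 1 f 0) -> forall t, f t = f 0.
Proof. by move=> d t; exact: is_derive_0_is_cst. Qed.

(** The quantities (u' + k u) e^(-kt) and (u' - k u) e^(kt) have zero derivative; u is recovered
    from these two constants. *)
Lemma linear_ode (R : realType) (k : R) (u u' : R -> R) : k != 0 ->
  (forall t : R, is_derive t 1 u (u' t)) ->
  (forall t : R, is_derive t 1 u' (k * k * u t)) ->
  exists A B, forall t, u t = A * expR (k * t) + B * expR (- (k * t)).
Proof.
move=> k0 du du'.
have dk (t : R) : is_derive t 1 (fun t : R => k * t) k.
  by apply: (is_der_eq (is_derM (is_der_cst k t) (is_der_id t))); ring.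
have dep t := is_der_exp (dk t).
have den t := is_der_exp (is_derN (dk t)).
have cf t : (u' t + k * u t) * expR (- (k * t)) = u' 0 + k * u 0.
  have d (s : R) : is_derive s 1 (fun t => (u' t + k * u t) * expR (- (k * t))) 0.
    apply: (is_der_eq (is_derM (is_derD (du' s) (is_derM (is_der_cst k s) (du s))) (den s))).
    by ring.
  by rewrite (der0_cst d t) mulr0 oppr0 expR0 mulr1.
have cg t : (u' t - k * u t) * expR (k * t) = u' 0 - k * u 0.
  have d (s : R) : is_derive s 1 (fun t => (u' t - k * u t) * expR (k * t)) 0.
    apply: (is_der_eq (is_derM (is_derB (du' s) (is_derM (is_der_cst k s) (du s))) (dep s))).
    by ring.
  by rewrite (der0_cst d t) mulr0 expR0 mulr1.
exists ((u' 0 + k * u 0) / (2 * k)), (- (u' 0 - k * u 0) / (2 * k)) => t.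
rewrite -(cf t) -(cg t) expRN; have e0 : expR (k * t) != 0 by rewrite gt_eqF ?expR_gt0.
by field; rewrite e0.
Qed.

Section Geodesic.
Variables (R : realType) (x y h x' y' h' : R -> R).
Hypothesis g : geodesic_ode x y h x' y' h'.

(* At the point (p, q, r), the restriction to H^3 of a linear form of the
   hyperboloid model. *)
Definition lform (a b c d : R) (p q r : R) : R :=
  (a * (p * p + q * q + r * r) + b * p + c * q + d) / r.

(** The squared hyperbolic speed. *)
Let E t := (x' t * x' t + y' t * y' t + h' t * h' t) / (h t * h t).

Lemma speed_cst t : E t = E 0.
Proof.
apply: der0_cst => {}t; have [h0 [dx dy dh] [dx' dy' dh']] := g t.
have hn0 : h t != 0 by rewrite gt_eqF.
have hh : h t * h t != 0 by rewrite mulf_neq0.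
apply: (is_der_eq (is_derM (is_derD (is_derD (is_derM dx' dx') (is_derM dy' dy'))
  (is_derM dh' dh')) (is_derV (f := fun t => h t * h t) hh (is_derM dh dh)))).
by field.
Qed.

Lemma lform_ode (k a b c d : R) : k != 0 -> E 0 = k * k ->
  exists A B, forall t, lform a b c d (x t) (y t) (h t) =
    A * expR (k * t) + B * expR (- (k * t)).
Proof.
move=> k0 Ek.
pose N t := a * (x t * x t + y t * y t + h t * h t) + b * x t + c * y t + d.
pose N' t := a * (2 * x t * x' t + 2 * y t * y' t + 2 * h t * h' t) + b * x' t + c * y' t.
apply: (linear_ode (u' := fun t => N' t * (h t)^-1 - N t * (h' t * ((h t)^-1 * (h t)^-1)))) => // t;
  have [h0 [dx dy dh] [dx' dy' dh']] := g t;
  have hn0 : h t != 0 by rewrite gt_eqF.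
all: have dS (r : R) (f : R -> R) (f' : R) (df : is_derive t 1 f f') :
    is_derive t 1 (fun t => r * f t) (r * f')
  by apply: (is_der_eq (is_derM (is_der_cst r t) df)); ring.
all: have dN : is_derive t 1 N (N' t)
  by apply: (is_der_eq (is_derD (is_derD (is_derD (dS a _ _ (is_derD (is_derD
    (is_derM dx dx) (is_derM dy dy)) (is_derM dh dh))) (dS b _ _ dx)) (dS c _ _ dy))
    (is_der_cst d t))); rewrite /N'; ring.
all: have dV := is_derV hn0 dh.
  apply: (is_der_eq (is_derM dN dV)).
  by field.
(* With k^2 replaced by the squared speed at t itself, the claim is a rational identity in the
   values at t. *)
rewrite -Ek -(speed_cst t) /E /lform.
have dN' := is_derD (is_derD (dS a _ _ (is_derD (is_derD
   (is_derM (dS 2 _ _ dx) dx') (is_derM (dS 2 _ _ dy) dy')) (is_derM (dS 2 _ _ dh) dh')))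
   (dS b _ _ dx')) (dS c _ _ dy').
apply: (is_der_eq (is_derB (is_derM dN' dV) (is_derM dN (is_derM dh' (is_derM dV dV))))).
by rewrite /N /N'; field.
Qed.

Lemma geodesic_cst t : E 0 = 0 -> [/\ x t = x 0, y t = y 0 & h t = h 0].
Proof.
move=> E0.
have S0 s : x' s = 0 /\ y' s = 0 /\ h' s = 0.
  have := speed_cst s; rewrite E0 /E => /eqP.
  have [h0 _ _] := g s; have hn0 : h s != 0 by rewrite gt_eqF.
  rewrite mulf_eq0 invr_eq0 mulf_eq0 !(negbTE hn0) !orbF -!expr2.
  by rewrite !paddr_eq0 ?addr_ge0 ?sqr_ge0 // !sqrf_eq0 => /andP[/andP[/eqP -> /eqP ->] /eqP ->].
split; apply: der0_cst => s; have [_ [dx dy dh] _] := g s;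
  have [a [b c]] := S0 s.
- by apply: (is_der_eq dx).
- by apply: (is_der_eq dy).
- by apply: (is_der_eq dh).
Qed.

End Geodesic.

(** * Ends of geodesics *)

Definition zform (R : realType) (a b c d : R) (z : 'rV[R]_3) : R :=
  lform a b c d (x1 z) (x2 z) (ht z).

Lemma exp_large (R : realType) (k T X : R) : 0 < k ->
  exists t, [/\ T < t, 0 <= t & X <= expR (k * t)].
Proof.
move=> k0; pose t := Num.max (Num.max 0 (T + 1)) (X / k).
have t1 : 0 <= t by rewrite !le_max lexx.
have t2 : T + 1 <= t by rewrite !le_max lexx orbT.
have t3 : X / k <= t by rewrite !le_max lexx !orbT.
exists t; split=> //; first by lra.
have := expR_ge1Dx (k * t); rewrite ler_pdivrMr // in t3.
by rewrite mulrC in t3; lra.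
Qed.

Lemma mul_inv_bound (R : realType) (D X : R) : 1 <= X -> - `|D| <= D * X^-1 <= `|D|.
Proof.
move=> X1; have X0 : 0 < X by lra.
have iX : `|X^-1| = X^-1 by rewrite ger0_norm // invr_ge0 ltW.
by rewrite -ler_norml normrM iX ler_piMr // invf_le1.
Qed.

Lemma exp_growth (R : realType) (k A B T M : R) : 0 < k ->
  (forall t, T < t -> - M <= A * expR (k * t) + B * expR (- (k * t))) -> 0 <= A.
Proof.
move=> k0 h; rewrite leNgt; apply/negP => A0.
have [t [tT t0 tX]] := exp_large T ((`|M| + `|B| + 1) / - A) k0.
have := h t tT; rewrite expRN.
have e1 : 1 <= expR (k * t) by rewrite -expR0 ler_expR mulr_ge0 // ltW.
have e0 : 0 < expR (k * t) := expR_gt0 _.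
have /andP[_ hB] := mul_inv_bound B e1.
have := ler_norm M.
by rewrite ler_pdivrMr ?oppr_gt0 // in tX; nra.
Qed.

Lemma cvg_Some (R : realType) (c : R -> 'rV[R]_3) (z : 'rV[R]_3) (V : set 'rV[R]_3) :
  point_at c +oo%E (Some z) -> nbhs z V -> exists T, forall t, T < t -> V (c t).
Proof.
move=> cz /one_point_compactification_some_nbhs /cz [T [_ h]].
by exists T => t /h [w Vw [<-]].
Qed.

Lemma cvg_None (R : realType) (c : R -> 'rV[R]_3) (M : R) :
  point_at c +oo%E None ->
  exists T, forall t, T < t -> ~ (forall i, - M <= c t 0 i <= M).
Proof.
move=> cN; pose K := [set v : 'rV[R]_3 | forall i, `[- M, M]%classic (v ord0 i)].
have Kc : compact K.
  by apply: (@rV_compact _ _ (fun=> `[- M, M]%classic)) => _; exact: segment_compact.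
have : nbhs (None : one_point_compactification 'rV[R]_3) ((Some @` (~` K)) `|` [set None]).
  by exists K => //; split=> //; apply: compact_closed => //; exact: norm_hausdorff.
move=> /cN [T [_ h]]; exists T => t /h [[w nw [<-]]|//] hw.
by apply: nw => i; rewrite /= in_itv /= -/(0 : 'I_1); have := hw i; rewrite [ord0](_ : _ = 0) //; apply: val_inj.
Qed.

(** Asked of all forms at once, because the analysis at the end oo compares the tested form with u,
    x_1/y, x_2/y and 1/y. *)
Definition exp_rep (R : realType) (k : R) (c : R -> 'rV[R]_3) : Prop :=
  forall a b b' d, exists A B, forall t,
    zform a b b' d (c t) = A * expR (k * t) + B * expR (- (k * t)).

(** Time reversal exchanges A and B, so only ends at +oo have to be analysed. *)
Lemma exp_rep_opp (R : realType) (k : R) (c : R -> 'rV[R]_3) :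
  exp_rep k c -> exp_rep k (fun t => c (- t)).
Proof.
move=> h a b b' d; have [A [B E]] := h a b b' d; exists B, A => t.
by rewrite E mulrN opprK addrC.
Qed.

Lemma zform_near (R : realType) (a b b' d e : R) (c : R -> 'rV[R]_3) (z : 'rV[R]_3) :
  0 < e -> point_at c +oo%E (Some z) -> H3 z -> 0 <= zform a b b' d z ->
  exists T, forall t, T < t -> - e < zform a b b' d (c t).
Proof.
move=> e0 cz z0 pz.
have cont : {for z, continuous (zform a b b' d)}.
  have c1 : {for z, continuous (@x1 R)} by exact: coord_continuous.
  have c2 : {for z, continuous (@x2 R)} by exact: coord_continuous.
  have ch : {for z, continuous (@ht R)} by exact: coord_continuous.
  have cc (r : R) : {for z, continuous (fun=> r : R)} by exact: cst_continuous.
  have cM (f g : 'rV[R]_3 -> R) : {for z, continuous f} -> {for z, continuous g} ->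
    {for z, continuous (fun w => f w * g w : R)} by move=> ? ?; exact: continuousM.
  have cD (f g : 'rV[R]_3 -> R) : {for z, continuous f} -> {for z, continuous g} ->
    {for z, continuous (fun w => f w + g w : R)} by move=> ? ?; exact: continuousD.
  rewrite /zform /lform; apply: (cM); last first.
    by apply: continuousV => //; rewrite gt_eqF.
  by repeat first [exact: c1 | exact: c2 | exact: ch | exact: cc | apply: (cM) | apply: (cD)].
have n1 : \forall w \near z, - e < zform a b b' d w by apply: (cvgr_gt _ cont); lra.
exact: cvg_Some cz n1.
Qed.

(** Close to z the form exceeds -1 along the curve, and this lower bound rules out a negative
    growing coefficient. *)
Lemma end_Some (R : realType) (k A B a b b' d : R) (c : R -> 'rV[R]_3) (z : 'rV[R]_3) :
  0 < k -> (forall t, zform a b b' d (c t) = A * expR (k * t) + B * expR (- (k * t))) ->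
  point_at c +oo%E (Some z) -> H3 z -> 0 <= zform a b b' d z -> 0 <= A.
Proof.
move=> k0 E cz z0 pz; have [T hT] := zform_near ltr01 cz z0 pz.
by apply: (@exp_growth R k A B T 1 k0) => t /hT /ltW; rewrite E.
Qed.

(* With w = 1/y and u = (|x|^2 + y^2)/y one has u w - |x/y|^2 = 1.  If the
   growing coefficient of w were positive, the geodesic would stay bounded; so
   it vanishes, and by the identity so do those of x_1/y and x_2/y. *)
Lemma end_None (R : realType) (k A B a b b' d : R) (c : R -> 'rV[R]_3) :
  0 < k -> (forall t, H3 (c t)) -> exp_rep k c ->
  (forall t, zform a b b' d (c t) = A * expR (k * t) + B * expR (- (k * t))) ->
  point_at c +oo%E None -> 0 <= a -> 0 <= A.
Proof.
move=> k0 c0 rep E cN a0.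
have [Au [Bu EU]] := rep 1 0 0 0; have [A1 [B1 E1]] := rep 0 1 0 0.
have [A2 [B2 E2]] := rep 0 0 1 0; have [A0 [B0 E0]] := rep 0 0 0 1.
have hn0 t : ht (c t) != 0 by rewrite gt_eqF //; exact: c0.
have EW t : (ht (c t))^-1 = A0 * expR (k * t) + B0 * expR (- (k * t)).
  by rewrite -E0 /zform /lform; field.
have EX1 t : x1 (c t) / ht (c t) = A1 * expR (k * t) + B1 * expR (- (k * t)).
  by rewrite -E1 /zform /lform; field.
have EX2 t : x2 (c t) / ht (c t) = A2 * expR (k * t) + B2 * expR (- (k * t)).
  by rewrite -E2 /zform /lform; field.
have Au0 : 0 <= Au.
  apply: (@exp_growth R k Au Bu 0 0 k0) => t _; rewrite -EU oppr0 /zform /lform.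
  rewrite mul1r !mul0r !addr0 divr_ge0 //; last exact/ltW/c0.
  by rewrite !addr_ge0 // -expr2 sqr_ge0.
have A00 : 0 <= A0.
  by apply: (@exp_growth R k A0 B0 0 0 k0) => t _; rewrite -EW oppr0 invr_ge0 ltW // c0.
have small (X C D : R) : 1 <= X -> `|C * X + D * X^-1| <= (`|C| + `|D|) * X.
  move=> X1; have X0 : 0 < X by lra.
  apply: (le_trans (ler_normD _ _)); rewrite !normrM mulrDl normfV (ger0_norm (ltW X0)).
  rewrite lerD2l ler_wpM2l //; by apply: le_trans (X1); rewrite invf_le1.
(* Otherwise 1/y >= A0 e^(kt) / 2 eventually, and x_1, x_2 and y, ratios of terms of order at most
   e^(kt), stay within [-M, M], against the escape to oo. *)
have {}A00 : A0 = 0.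
  apply/eqP; rewrite eq_le A00 andbT leNgt; apply/negP => A0p.
  pose M := 2 * (`|A1| + `|B1| + `|A2| + `|B2| + 1) / A0.
  have [T hT] := cvg_None M cN.
  have [t [tT t0 tX]] := exp_large T (1 + 2 * `|B0| / A0) k0.
  apply: (hT t tT); set X := expR (k * t) in tX.
  have n0 r : 0 <= `|r : R| by exact: normr_ge0.
  have q0 : 0 <= 2 * `|B0| / A0 by rewrite divr_ge0 ?mulr_ge0 // ltW.
  have X1 : 1 <= X by lra.
  have X0 : 0 < X by lra.
  have hB : 2 * `|B0| <= A0 * X by rewrite (mulrC A0) -ler_pdivrMr //; lra.
  have W1 : A0 * X / 2 <= (ht (c t))^-1.
    rewrite EW expRN -/X; have /andP[+ _] := mul_inv_bound B0 X1.
    by lra.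
  have h1 : ht (c t) <= 2 / (A0 * X).
    rewrite -[ht _]invrK -[2 / _]invrK lef_pV2 ?posrE ?invr_gt0 ?divr_gt0 ?mulr_gt0 //; last exact: c0.
    by rewrite invf_div.
  have co (C D v : R) : v / ht (c t) = C * X + D * X^-1 ->
      `|C| + `|D| <= `|A1| + `|B1| + `|A2| + `|B2| + 1 -> - M <= v <= M.
    move=> Ev CD; rewrite -ler_norml -[v](divfK (hn0 t)) Ev normrM.
    rewrite (ger0_norm (ltW (c0 t))).
    apply: (@le_trans _ _ ((`|C| + `|D|) * X * (2 / (A0 * X)))).
      by rewrite ler_pM // ?small // ltW // c0.
    rewrite (_ : _ * _ = 2 * (`|C| + `|D|) / A0); last by field; rewrite !gt_eqF.
    by rewrite ler_pM2r ?invr_gt0 // ler_pM2l.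
  have Z1 := n0 A1; have Z2 := n0 A2; have Z3 := n0 B1; have Z4 := n0 B2.
  apply: ord3P.
  - by apply: (co A1 B1); [rewrite -expRN -EX1 | lra].
  - by apply: (co A2 B2); [rewrite -expRN -EX2 | lra].
  - rewrite -ler_norml (ger0_norm (ltW (c0 t))); apply: (le_trans h1).
    apply: (@le_trans _ _ (2 / A0)).
      by rewrite ler_pM2l // lef_pV2 ?posrE ?mulr_gt0 // ler_peMr // ltW.
    by rewrite /M ler_pM2r ?invr_gt0 //; lra.
(* With A0 = 0 the coefficient of e^(2kt) in u w - |x/y|^2 is -(A1^2 + A2^2), while the whole
   expression is 1. *)
have A12 : A1 * A1 + A2 * A2 = 0.
  have A12 : 0 <= A1 * A1 + A2 * A2 by rewrite addr_ge0 // -expr2 sqr_ge0.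
  apply/eqP; rewrite eq_le A12 andbT.
  rewrite -oppr_ge0; apply: (@exp_growth R (k * 2) _ (Bu * B0 - B1 * B1 - B2 * B2) 0
    (`|Au * B0 - 2 * A1 * B1 - 2 * A2 * B2 - 1|)); first by rewrite mulr_gt0.
  move=> t _; set X := expR (k * t); have X0 : X != 0 by rewrite gt_eqF ?expR_gt0.
  have -> : expR (k * 2 * t) = X * X by rewrite -expRD; congr expR; ring.
  rewrite expRN (_ : expR (k * 2 * t) = X * X); last by rewrite -expRD; congr expR; ring.
  have id : zform 1 0 0 0 (c t) * (ht (c t))^-1 - (x1 (c t) / ht (c t)) ^+ 2 -
      (x2 (c t) / ht (c t)) ^+ 2 = 1.
    by rewrite /zform /lform; field.
  rewrite EU EX1 EX2 EW A00 expRN -/X in id.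
  rewrite lerNl [leLHS](_ : _ = Au * B0 - 2 * A1 * B1 - 2 * A2 * B2 - 1); first exact: ler_norm.
  by apply: (addIr 1); rewrite subrK -[X in _ + X = _]id; field.
have {A12} [A10 A20] : A1 = 0 /\ A2 = 0.
  move/eqP: A12; rewrite paddr_eq0 ?(-expr2, sqr_ge0) // -?expr2 ?sqr_ge0 //.
  by rewrite !sqrf_eq0 => /andP[/eqP -> /eqP ->].
(* Only u retains a growing term, so the form grows like a times u, and a >= 0. *)
apply: (@exp_growth R k A B 0 (`|a * Bu + b * B1 + b' * B2 + d * B0|) k0) => t t0.
rewrite -E (_ : zform a b b' d (c t) = a * zform 1 0 0 0 (c t) +
  b * (x1 (c t) / ht (c t)) + b' * (x2 (c t) / ht (c t)) + d * (ht (c t))^-1); last first.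
  by rewrite /zform /lform; field.
rewrite EU EX1 EX2 EW A00 A10 A20 expRN; set X := expR (k * t).
have X1 : 1 <= X by rewrite -expR0 ler_expR mulr_ge0 // ltW.
have X0 : 0 < X by lra.
rewrite [leRHS](_ : _ = a * Au * X + (a * Bu + b * B1 + b' * B2 + d * B0) * X^-1); last by ring.
have : 0 <= a * Au * X by rewrite !mulr_ge0 // ltW.
have /andP[+ _] := mul_inv_bound (a * Bu + b * B1 + b' * B2 + d * B0) X1.
by lra.
Qed.

(** * Convexity of the solid *)

Lemma ereal_cases (R : realType) (e : \bar R) :
  (exists r, e = r%:E) \/ (e = +oo%E \/ e = -oo%E).
Proof. by case: e => [r||]; [left; exists r | right; left | right; right]. Qed.

Lemma point_at_opp (R : realType) (c : R -> 'rV[R]_3) p :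
  point_at c -oo%E p -> point_at (fun t => c (- t)) +oo%E p.
Proof.
rewrite /point_at /= => h U /h [M [_ hM]]; exists (- M); split; first exact: num_real.
by move=> t Mt; apply: hM; rewrite ltrNl.
Qed.

(** Nothing is asked at oo: there the sign is governed by the coefficient a, which [form_convex]
    takes nonnegative. *)
Definition end_ok (R : realType) (a b b' d : R)
    (p : one_point_compactification 'rV[R]_3) : Prop :=
  if p is Some z then H3 z /\ 0 <= zform a b b' d z else True.

Lemma cst_end (R : realType) (a b b' d : R) (c : R -> 'rV[R]_3) w p :
  (forall t, c t = w) -> point_at c +oo%E p -> end_ok a b b' d p ->
  0 <= zform a b b' d w.
Proof.
move=> cw; case: p => [z cz [z0 pz]|cN _].
  rewrite leNgt; apply/negP => lt0.
  have e0 : 0 < - zform a b b' d w by rewrite oppr_gt0.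
  have [T /(_ (T + 1))] := zform_near e0 cz z0 pz.
  by rewrite cw opprK ltxx ltrDl ltr01 => /(_ isT).
have [T hT] := cvg_None (`|w 0 0| + `|w 0 1| + `|w 0 2|) cN.
exfalso; apply: (hT (T + 1)); first by rewrite ltrDl.
move=> i; rewrite cw -ler_norml.
have h0 := normr_ge0 (w 0 0); have h1 := normr_ge0 (w 0 1); have h2 := normr_ge0 (w 0 2).
by move: i; apply: ord3P; lra.
Qed.

(** Multiplied by X = e^(ks) > 0, the form becomes A X^2 + B, affine in the increasing quantity X^2.
    Nonnegativity at both ends therefore suffices, an infinite end giving the sign of A at +oo or of
    B at -oo. *)
Lemma form_convex (R : realType) (a b b' d : R) (c : R -> 'rV[R]_3)
    (al be : \bar R) p q :
  0 <= a -> geodesic_line c -> point_at c al p -> point_at c be q ->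
  end_ok a b b' d p -> end_ok a b b' d q ->
  forall t : R, (al < t%:E)%E -> (t%:E < be)%E -> 0 <= zform a b b' d (c t).
Proof.
move=> a0 gc pa qb hp hq t at_ tb.
have c0 s : H3 (c s) by have [] := gc s.
have [x' [y' [h' g]]] := geodesic_lineP gc.
pose E0 := (x' 0 * x' 0 + y' 0 * y' 0 + h' 0 * h' 0) / (ht (c 0) * ht (c 0)).
have E00 : 0 <= E0 by rewrite divr_ge0 ?addr_ge0 -?expr2 ?sqr_ge0.
have [Ez|En] := eqVneq E0 0.
  have cc s : c s = c t.
    have [e1 e2 e3] := geodesic_cst g s Ez; have [f1 f2 f3] := geodesic_cst g t Ez.
    by apply: row3_inj; rewrite ?e1 ?e2 ?e3 ?f1 ?f2 ?f3.
  have [[r ar]|[ap|am]] := ereal_cases al.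
  - by move: pa hp; rewrite ar /= => -> [_]; rewrite cc.
  - by move: at_; rewrite ap.
  - rewrite am in pa; apply: (cst_end (c := fun s => c (- s)) _ (point_at_opp pa) hp).
    by move=> s; exact: cc.
pose k := Num.sqrt E0.
have k0 : 0 < k by rewrite sqrtr_gt0 lt_neqAle eq_sym En.
have kE : E0 = k * k by rewrite -expr2 sqr_sqrtr.
have rep : exp_rep k c.
  move=> r1 r2 r3 r4; have [A [B AB]] := lform_ode g r1 r2 r3 r4 (lt0r_neq0 k0) kE.
  by exists A, B => s; exact: AB.
have [A [B AB]] := rep a b b' d.
pose X s := expR (k * s).
have X0 s : 0 < X s := expR_gt0 _.
have XX s : 0 < X s * X s by rewrite mulr_gt0.
have XE s : zform a b b' d (c s) = (A * (X s * X s) + B) / X s.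
  by rewrite AB expRN -/(X s); field; rewrite gt_eqF.
have Xpos s : (0 <= zform a b b' d (c s)) = (0 <= A * (X s * X s) + B).
  by rewrite XE pmulr_lge0 ?invr_gt0.
have Xlt s s' : s < s' -> X s * X s <= X s' * X s'.
  move=> ss; have : X s <= X s' by rewrite ler_expR ler_pM2l // ltW.
  by move=> h; rewrite ler_pM // ltW.
have real_end r w : point_at c r%:E w -> end_ok a b b' d w -> 0 <= A * (X r * X r) + B.
  by move=> /= -> [_]; rewrite Xpos.
have A0 : be = +oo%E -> 0 <= A.
  move=> bE; rewrite bE in qb; case: q qb hq => [z|] qb hq.
    by case: hq; exact: end_Some k0 AB qb.
  exact: end_None k0 c0 rep AB qb a0.
have B0 : al = -oo%E -> 0 <= B.
  move=> aE; rewrite aE in pa; have {}pa := point_at_opp pa.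
  have BA s : zform a b b' d (c (- s)) = B * expR (k * s) + A * expR (- (k * s)).
    by rewrite AB mulrN opprK addrC.
  case: p pa hp => [z|] pa hp.
    by case: hp; exact: (end_Some k0 BA pa).
  exact: (end_None k0 (fun s => c0 (- s)) (exp_rep_opp rep) BA pa a0).
rewrite Xpos; have Xt := XX t.
have [[r ar]|[ap|am]] := ereal_cases al; last 1 first.
- have {}B0 := B0 am.
  have [A1|A1] := lerP 0 A; first by rewrite addr_ge0 // mulr_ge0 // ltW.
  have [[r br]|[bp|bm]] := ereal_cases be.
  + have h := real_end _ _ (eq_ind _ (fun e => point_at c e q) qb _ br) hq.
    have rt : t < r by move: tb; rewrite br lte_fin.
    by have := Xlt _ _ rt; nra.
  + by have := A0 bp; rewrite leNgt A1.
  + by move: tb; rewrite bm.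
- have h1 := real_end _ _ (eq_ind _ (fun e => point_at c e p) pa _ ar) hp.
  have rt : r < t by move: at_; rewrite ar lte_fin.
  have X1 := Xlt _ _ rt.
  have [A1|A1] := lerP 0 A; first by nra.
  have [[r' br]|[bp|bm]] := ereal_cases be.
  + have h := real_end _ _ (eq_ind _ (fun e => point_at c e q) qb _ br) hq.
    have rt' : t < r' by move: tb; rewrite br lte_fin.
    by have := Xlt _ _ rt'; nra.
  + by have := A0 bp; rewrite leNgt A1.
  + by move: tb; rewrite bm.
- by move: at_; rewrite ap.
Qed.

Definition solid (R : realType) : set 'rV[R]_3 :=
  [set z | [/\ H3 z, in_tri (x1 z) (x2 z) & 2 <= sph z]].

(** The four faces as linear forms: three vertical planes, with a = 0, and the hemisphere, with a =
    1. *)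
Lemma solidP (R : realType) (z : 'rV[R]_3) : H3 z ->
  solid z <-> [/\ 0 <= zform 0 1 0 (-1) z, 0 <= zform 0 0 1 0 z,
    0 <= zform 0 (-1) (-1) 2 z & 0 <= zform 1 (-2) 0 (-1) z].
Proof.
move=> z0; have h0 : 0 < (ht z)^-1 by rewrite invr_gt0.
rewrite /zform /lform !pmulr_lge0 // /solid /sph /in_tri /= !expr2.
move: z0; rewrite /H3 /=; move: (x1 z) (x2 z) (ht z) => u v r r0.
by split=> [[_ [? ? ?] ?]|[? ? ? ?]]; repeat split => //; nra.
Qed.

Lemma solid_convex (R : realType) :
  geodesically_convex ([set Some z | z in @solid R] `|` [set None]).
Proof.
split.
  by move=> _ [[z [z0 _ _] <-]|->] //; exact: ltW z0.
move=> c al be p q gc pa qb hp hq t at_ tb; left; exists (c t) => //.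
have ok (a b b' d : R) r : (forall z : 'rV[R]_3, solid z -> 0 <= zform a b b' d z) ->
    ([set Some z | z in @solid R] `|` [set None]) r -> end_ok a b b' d r.
  by move=> h [[z sz <-]|->] //=; split; [case: sz | exact: h].
have c0 : H3 (c t) by have [] := gc t.
have f1 (z : 'rV[R]_3) : solid z -> 0 <= zform 0 1 0 (-1) z.
  by move=> sz; have z0 : H3 z by [case: sz]; have [] := (solidP z0).1 sz.
have f2 (z : 'rV[R]_3) : solid z -> 0 <= zform 0 0 1 0 z.
  by move=> sz; have z0 : H3 z by [case: sz]; have [] := (solidP z0).1 sz.
have f3 (z : 'rV[R]_3) : solid z -> 0 <= zform 0 (-1) (-1) 2 z.
  by move=> sz; have z0 : H3 z by [case: sz]; have [] := (solidP z0).1 sz.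
have f4 (z : 'rV[R]_3) : solid z -> 0 <= zform 1 (-2) 0 (-1) z.
  by move=> sz; have z0 : H3 z by [case: sz]; have [] := (solidP z0).1 sz.
apply/solidP => //; split.
- by apply: (form_convex _ gc pa qb (ok _ _ _ _ _ f1 hp) (ok _ _ _ _ _ f1 hq) at_ tb).
- by apply: (form_convex _ gc pa qb (ok _ _ _ _ _ f2 hp) (ok _ _ _ _ _ f2 hq) at_ tb).
- by apply: (form_convex _ gc pa qb (ok _ _ _ _ _ f3 hp) (ok _ _ _ _ _ f3 hq) at_ tb).
- by apply: (form_convex _ gc pa qb (ok _ _ _ _ _ f4 hp) (ok _ _ _ _ _ f4 hq) at_ tb).
Qed.

(** * Explicit geodesics *)

Section Arc.
Variable R : realType.
Implicit Types t s : R.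

(** tanh, with 1/cosh and artanh after it: they parametrize a half-circle at unit hyperbolic
    speed. *)
Definition htan t : R := (expR t * expR t - 1) / (expR t * expR t + 1).
Definition hsec t : R := 2 * expR t / (expR t * expR t + 1).
Definition hatan s : R := ln ((1 + s) / (1 - s)) / 2.

Lemma hden_neq0 t : expR t * expR t + 1 != 0.
Proof. by rewrite gt_eqF // addr_gt0 // mulr_gt0 ?expR_gt0. Qed.

Lemma hsec_gt0 t : 0 < hsec t.
Proof. by rewrite divr_gt0 ?mulr_gt0 ?addr_gt0 ?expR_gt0 // mulr_gt0 ?expR_gt0. Qed.

Lemma htan_hsec t : htan t * htan t + hsec t * hsec t = 1.
Proof. by rewrite /htan /hsec; field; exact: hden_neq0. Qed.

Lemma is_der_htan t : is_derive t 1 htan (hsec t * hsec t).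
Proof.
have d0 := hden_neq0 t; have de := is_der_exp (is_der_id t).
have dE := is_derM de de.
apply: (is_der_eq (is_derM (is_derB dE (is_der_cst 1 t))
  (is_derV (f := fun t => expR t * expR t + 1) d0 (is_derD dE (is_der_cst 1 t))))).
by rewrite /hsec; field.
Qed.

Lemma is_der_hsec t : is_derive t 1 hsec (- (htan t * hsec t)).
Proof.
have d0 := hden_neq0 t; have de := is_der_exp (is_der_id t).
have dE := is_derM de de.
apply: (is_der_eq (is_derM (is_derM (is_der_cst 2 t) de)
  (is_derV (f := fun t => expR t * expR t + 1) d0 (is_derD dE (is_der_cst 1 t))))).
by rewrite /hsec /htan; field.
Qed.

Lemma hatanK s : -1 < s < 1 -> htan (hatan s) = s.
Proof.
move=> /andP[s1 s2]; rewrite /htan -expRD.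
have -> : hatan s + hatan s = ln ((1 + s) / (1 - s)) by rewrite /hatan; field.
have p1 : 0 < 1 + s by lra.
have p2 : 0 < 1 - s by lra.
rewrite lnK ?posrE ?divr_gt0 //; field; apply/andP; split; rewrite gt_eqF //.
by rewrite (_ : _ + _ = 2) //; ring.
Qed.

Lemma lt_hatan s s' : -1 < s -> s < s' -> s' < 1 -> hatan s < hatan s'.
Proof.
move=> s1 ss s2; rewrite ltr_pM2r ?invr_gt0 // ltr_ln ?posrE ?divr_gt0 //; try lra.
rewrite ltr_pdivrMr; last by lra.
rewrite mulrAC ltr_pdivlMr; last by lra.
by nra.
Qed.

Lemma arc_geodesic (m1 m2 r e1 e2 : R) : 0 < r -> e1 * e1 + e2 * e2 = 1 ->
  geodesic_line (fun t => row3 (m1 + r * e1 * htan t) (m2 + r * e2 * htan t) (r * hsec t)).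
Proof.
move=> r0 e12.
have dS (b : R) (f : R -> R) (t f' : R) (df : is_derive t 1 f f') :
    is_derive t 1 (fun t => b * f t) (b * f').
  by apply: (is_der_eq (is_derM (is_der_cst b t) df)); ring.
apply: (line_geodesic (x' := fun t => r * e1 * (hsec t * hsec t))
  (y' := fun t => r * e2 * (hsec t * hsec t))
  (h' := fun t => r * - (htan t * hsec t))) => t.
have S0 := hsec_gt0 t; have Sn0 : hsec t != 0 by rewrite gt_eqF.
have rn0 : r != 0 by rewrite gt_eqF.
have dT := is_der_htan t; have dC := is_der_hsec t.
split; first exact: mulr_gt0.
- split.
  + by apply: (is_der_eq (is_derD (is_der_cst m1 t) (dS (r * e1) _ _ _ dT))); ring.
  + by apply: (is_der_eq (is_derD (is_der_cst m2 t) (dS (r * e2) _ _ _ dT))); ring.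
  + exact: dS dC.
- split.
  + by apply: (is_der_eq (dS (r * e1) _ _ _ (is_derM dC dC))); field; rewrite ?rn0 ?Sn0.
  + by apply: (is_der_eq (dS (r * e2) _ _ _ (is_derM dC dC))); field; rewrite ?rn0 ?Sn0.
  + apply: (is_der_eq (dS r _ _ _ (is_derN (is_derM dT dC)))).
    transitivity ((r * - (htan t * hsec t) * (r * - (htan t * hsec t)) -
      (e1 * e1 + e2 * e2) * (r * (hsec t * hsec t)) * (r * (hsec t * hsec t))) / (r * hsec t)).
      by rewrite e12; field; rewrite ?rn0 ?Sn0.
    by field; rewrite ?rn0 ?Sn0.
Qed.

Lemma vertical_geodesic (a b : R) : geodesic_line (fun t => row3 a b (expR t)).
Proof.
apply: (line_geodesic (x' := fun=> 0) (y' := fun=> 0) (h' := expR)) => t.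
have e0 := expR_gt0 t; have en0 : expR t != 0 by rewrite gt_eqF.
split=> //; split.
- exact: is_der_cst.
- exact: is_der_cst.
- by apply: (is_der_eq (is_der_exp (is_der_id t))); ring.
- by apply: (is_der_eq (is_der_cst 0 t)); ring.
- by apply: (is_der_eq (is_der_cst 0 t)); ring.
- by apply: (is_der_eq (is_der_exp (is_der_id t))); field.
Qed.

Lemma vertical_end (a b : R) :
  point_at (fun t => row3 a b (expR t)) +oo%E None.
Proof.
rewrite /point_at => U [K [Kc _] KU].
have : bounded_set (@ht R @` K).
  apply: compact_bounded; apply: continuous_compact => //.
  by apply: continuous_subspaceT => z; exact: coord_continuous.
move=> [M [_ hM]]; exists `|M|; split; first exact: num_real.
move=> t tM; apply: KU; left; exists (row3 a b (expR t)) => // Kt.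
have M1 : M < `|M| + 1 by have := ler_norm M; lra.
have := hM _ M1 _ (ex_intro2 _ _ _ Kt erefl); rewrite /= /ht mxE /=.
rewrite gtr0_norm ?expR_gt0 // => h.
by have := expR_ge1Dx t; lra.
Qed.

Variable S : set (one_point_compactification 'rV[R]_3).
Hypothesis Sconv : geodesically_convex S.

Lemma convex_vertical (w z : 'rV[R]_3) : H3 w -> S (Some w) -> S None ->
  x1 z = x1 w -> x2 z = x2 w -> ht w <= ht z -> S (Some z).
Proof.
move=> w0 Sw SN e1 e2; rewrite le_eqVlt => /orP[/eqP e3|wz].
  by rewrite (row3_inj e1 e2 (esym e3)).
have z0 : 0 < ht z by apply: lt_trans wz.
have pw : point_at (fun t => row3 (x1 w) (x2 w) (expR t)) (ln (ht w))%:E (Some w).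
  by rewrite /= lnK // -row3E.
have := Sconv.2 _ _ _ _ _ (vertical_geodesic (x1 w) (x2 w)) pw
  (vertical_end (x1 w) (x2 w)) Sw SN (ln (ht z)).
rewrite lnK // -e1 -e2 -row3E; apply; last exact: ltry.
by rewrite lte_fin ltr_ln.
Qed.

(* Geodesics of the hemisphere [sph = 2] project to straight segments. *)
Lemma convex_arc (w1 w2 w : 'rV[R]_3) (l : R) : H3 w1 -> H3 w2 -> H3 w ->
  sph w1 = 2 -> sph w2 = 2 -> sph w = 2 -> 0 <= l <= 1 ->
  (x1 w1 != x1 w2) || (x2 w1 != x2 w2) ->
  x1 w = x1 w1 + l * (x1 w2 - x1 w1) -> x2 w = x2 w1 + l * (x2 w2 - x2 w1) ->
  S (Some w1) -> S (Some w2) -> S (Some w).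
Proof.
move=> z1 z2 z s1 s2 s /andP[l0 l1] ne E1 E2 S1 S2.
pose v1 := x1 w2 - x1 w1; pose v2 := x2 w2 - x2 w1.
pose L := Num.sqrt (v1 * v1 + v2 * v2).
have Lp : 0 < v1 * v1 + v2 * v2.
  rewrite lt_neqAle eq_sym addr_ge0 -?expr2 ?sqr_ge0 // andbT.
  rewrite paddr_eq0 ?sqr_ge0 // !sqrf_eq0 !subr_eq0 negb_and.
  by rewrite (eq_sym (x1 w2)) (eq_sym (x2 w2)).
have L0 : 0 < L by rewrite sqrtr_gt0.
have LL : L * L = v1 * v1 + v2 * v2 by rewrite -expr2 sqr_sqrtr // ltW.
have Ln0 : L != 0 by rewrite gt_eqF.
pose e1 := v1 / L; pose e2 := v2 / L.
have e12 : e1 * e1 + e2 * e2 = 1.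
  transitivity ((v1 * v1 + v2 * v2) / (L * L)); first by rewrite /e1 /e2; field.
  by rewrite -LL divff // mulf_neq0.
have Lv1 : v1 = L * e1 by rewrite /e1; field.
have Lv2 : v2 = L * e2 by rewrite /e2; field.
pose u1 := x1 w1 - 1; pose u2 := x2 w1.
(* The half-circle is centred at the foot of the perpendicular from 1 to the line through the
   projections; a is the signed distance from that foot to the projection of w1, and w1 + k v has
   parameter artanh((a + k L) / r). *)
pose a := u1 * e1 + u2 * e2.
pose r := Num.sqrt (ht w1 * ht w1 + a * a).
have rp : 0 < ht w1 * ht w1 + a * a.
  by rewrite ltr_pwDl ?mulr_gt0 // -expr2 sqr_ge0.
have r0 : 0 < r by rewrite sqrtr_gt0.
have rr : r * r = ht w1 * ht w1 + a * a by rewrite -expr2 sqr_sqrtr // ltW.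
have rn0 : r != 0 by rewrite gt_eqF.
pose c t := row3 (1 + u1 - a * e1 + r * e1 * htan t) (u2 - a * e2 + r * e2 * htan t) (r * hsec t).
have gc : geodesic_line c by exact: arc_geodesic.
have at_ k y : H3 y -> sph y = 2 -> x1 y = x1 w1 + k * v1 -> x2 y = x2 w1 + k * v2 ->
    -1 < (a + k * L) / r < 1 /\ c (hatan ((a + k * L) / r)) = y.
  move=> y0 sy h1 h2.
  have hy : ht y * ht y = r * r - (a + k * L) * (a + k * L).
    move: s1 sy; rewrite /sph h1 h2 rr Lv1 Lv2 => s1 sy.
    have -> : ht y * ht y = 2 - (u1 + k * L * e1) ^+ 2 - (u2 + k * L * e2) ^+ 2.
      by rewrite -sy /u1 /u2; ring.
    have -> : ht w1 * ht w1 = 2 - u1 ^+ 2 - u2 ^+ 2 by rewrite -s1 /u1 /u2; ring.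
    transitivity (2 - u1 ^+ 2 - u2 ^+ 2 - 2 * k * L * a - k * k * L * L * (e1 * e1 + e2 * e2)).
      by rewrite /a; ring.
    by rewrite e12; ring.
  have yp : 0 < ht y * ht y by rewrite mulr_gt0.
  have bd : -1 < (a + k * L) / r < 1.
    by rewrite ltr_pdivlMr // ltr_pdivrMr //; apply/andP; split; nra.
  split=> //; rewrite /c (hatanK bd).
  have := htan_hsec (hatan ((a + k * L) / r)); rewrite (hatanK bd).
  set C := hsec _ => hC.
  have C0 : 0 < C by exact: hsec_gt0.
  have rC : r * C = ht y.
    have h3 : (r * C) ^+ 2 = ht y ^+ 2.
      rewrite [RHS]expr2 hy; transitivity (r * r * (C * C)); first by ring.
      have -> : C * C = 1 - (a + k * L) / r * ((a + k * L) / r) by rewrite -hC; ring.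
      by field.
    move/eqP: h3; rewrite eqrXn2 // ?mulr_ge0 // ?ltW // => /eqP //.
  rewrite rC [RHS]row3E h1 h2; congr row3.
  - by rewrite Lv1 /u1; field.
  - by rewrite Lv2 /u2; field.
have [b1 c1] := at_ 0 w1 z1 s1 ltac:(by rewrite mul0r addr0) ltac:(by rewrite mul0r addr0).
have [b2 c2] := at_ 1 w2 z2 s2 ltac:(by rewrite /v1; ring) ltac:(by rewrite /v2; ring).
have [b c3] := at_ l w z s E1 E2.
have [le0|ln0] := eqVneq l 0.
  by rewrite -c3 le0 c1.
have [le1|ln1] := eqVneq l 1.
  by rewrite -c3 le1 c2.
have l0' : 0 < l by rewrite lt_neqAle eq_sym ln0.
have l1' : l < 1 by rewrite lt_neqAle ln1.
have p1 : point_at c (hatan ((a + 0 * L) / r))%:E (Some w1) by rewrite /= c1.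
have p2 : point_at c (hatan ((a + 1 * L) / r))%:E (Some w2) by rewrite /= c2.
have := Sconv.2 _ _ _ _ _ gc p1 p2 S1 S2 (hatan ((a + l * L) / r)).
rewrite c3; apply; rewrite lte_fin.
- apply: lt_hatan; [by case/andP: b1 | | by case/andP: b].
  by rewrite ltr_pM2r ?invr_gt0 //; nra.
- apply: lt_hatan; [by case/andP: b | | by case/andP: b2].
  by rewrite ltr_pM2r ?invr_gt0 //; nra.
Qed.

End Arc.

(** * The convex hull *)

Definition lift (R : realType) (x y : R) : 'rV[R]_3 :=
  row3 x y (Num.sqrt (2 - (x - 1) ^+ 2 - y ^+ 2)).

Lemma lift_tri (R : realType) (x y : R) : in_tri x y ->
  H3 (lift x y) /\ sph (lift x y) = 2.
Proof.
move=> [h1 h2 h3].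
have p : 0 < 2 - (x - 1) ^+ 2 - y ^+ 2 by nra.
rewrite /H3 /sph /lift /=; have [-> -> ->] := row3K x y (Num.sqrt (2 - (x - 1) ^+ 2 - y ^+ 2)).
by rewrite sqrtr_gt0 sqr_sqrtr ?ltW //; split=> //; ring.
Qed.

(** One inclusion is the convexity of the solid. For the other, arcs from the apex above 1 to the
    edge above the hypotenuse cover the floor, and vertical rays to oo cover the rest. *)
Lemma solid_hull (R : realType) :
  [set Some z | z in @solid R] `|` [set None] =
  hyp_hull [set Some (row3 1 0 (Num.sqrt 2)); Some (row3 2 0 1);
                Some (row3 1 1 1); None].
Proof.
have PE : row3 1 0 (Num.sqrt 2) = lift 1 0 :> 'rV[R]_3.
  by rewrite /lift; congr (row3 _ _ (Num.sqrt _)); ring.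
have QE : row3 2 0 1 = lift 2 0 :> 'rV[R]_3.
  rewrite /lift [X in Num.sqrt X](_ : _ = 1); [by rewrite sqrtr1 | by ring].
have RE : row3 1 1 1 = lift 1 1 :> 'rV[R]_3.
  rewrite /lift [X in Num.sqrt X](_ : _ = 1); [by rewrite sqrtr1 | by ring].
rewrite PE QE RE.
have tP : in_tri (1 : R) 0 by split; lra.
have tQ : in_tri (2 : R) 0 by split; lra.
have tR : in_tri (1 : R) 1 by split; lra.
have lx x y : x1 (lift x y) = x :> R by have [] := row3K x y (Num.sqrt (2 - (x - 1) ^+ 2 - y ^+ 2)).
have ly x y : x2 (lift x y) = y :> R by have [] := row3K x y (Num.sqrt (2 - (x - 1) ^+ 2 - y ^+ 2)).
apply/seteqP; split; last first.
  apply: smallest_sub; first exact: solid_convex.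
  have sl (x y : R) : in_tri x y -> solid (lift x y).
    by move=> T; have [h1 h2] := lift_tri T; split; rewrite ?lx ?ly ?h2.
  by move=> _ [[[->|->]|->]|->]; [left; exists (lift 1 0) | left; exists (lift 2 0) | left; exists (lift 1 1) | right];
     rewrite //; exact: sl.
move=> p hp S [Sc SV].
have SP : S (Some (lift 1 0)) by apply: SV; left; left; left.
have SQ : S (Some (lift 2 0)) by apply: SV; left; left; right.
have SR : S (Some (lift 1 1)) by apply: SV; left; right.
have SN : S None by apply: SV; right.
case: hp => [[z [z0 T hz] <-]|->] //.
have arc (a b a' b' a'' b'' l : R) : in_tri a b -> in_tri a' b' -> in_tri a'' b'' ->
    0 <= l <= 1 -> (a != a') || (b != b') -> a'' = a + l * (a' - a) ->
    b'' = b + l * (b' - b) -> S (Some (lift a b)) -> S (Some (lift a' b')) ->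
    S (Some (lift a'' b'')).
  move=> t1 t2 t3 l01 ne e1 e2.
  have [p1 q1] := lift_tri t1; have [p2 q2] := lift_tri t2; have [p3 q3] := lift_tri t3.
  by apply: (convex_arc Sc p1 p2 p3 q1 q2 q3 l01); rewrite ?lx ?ly.
have edge l : 0 <= l <= 1 -> S (Some (lift (2 - l) l)).
  move=> l01; have /andP[l0 l1] := l01.
  apply: (arc 2 0 1 1 _ _ l) => //; try by [split; lra | ring].
  by rewrite gt_eqF // ltr1n.
(* The ray from 1 through x(z) meets the hypotenuse at parameter x_2 / s, and x(z) divides that
   segment in ratio s; for s = 0 the point lies above 1 itself. *)
have Sw : S (Some (lift (x1 z) (x2 z))).
  have [h1 h2 h3] := T; pose s := x1 z - 1 + x2 z.
  have [s0|sn0] := eqVneq s 0.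
    have -> : x1 z = 1 by rewrite /s in s0; lra.
    have -> : x2 z = 0 by rewrite /s in s0; lra.
    exact: SP.
  have s0 : 0 < s by rewrite lt_neqAle eq_sym sn0 /s; lra.
  have l01 : 0 <= x2 z / s <= 1.
    apply/andP; split; first by apply: divr_ge0 => //; exact: ltW.
    by rewrite ler_pdivrMr // mul1r /s; lra.
  have := edge _ l01; apply: (arc 1 0 _ _ _ _ s) => //; rewrite -/s.
  - by case/andP: l01 => ? ?; split; lra.
  - by apply/andP; split; rewrite /s; lra.
  - rewrite -negb_and; apply/negP => /andP[/eqP e1 /eqP e2].
    by move/eqP: e1; rewrite -e2 subr0 (eqr_nat R 1 2).
  - by rewrite /s in sn0 *; field.
  - by field.
have [w0 ws] := lift_tri T.
apply: (convex_vertical Sc w0 Sw SN); rewrite ?lx ?ly //.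
have : ht (lift (x1 z) (x2 z)) ^+ 2 <= ht z ^+ 2.
  by move: ws hz; rewrite /sph lx ly; lra.
rewrite ler_sqr ?nnegrE //; exact: ltW.
Qed.

Theorem proposition1p2p2p11 (R : realType) :
  let G : set (R * R) := triangle (1, 0) (2, 0) (1, 1) in
  let F : set 'rV[R]_3 := grenier (@Gamma R) G in
  [/\ [set Some z | z in F] `|` [set None] =
        hyp_hull [set Some (row3 1 0 (Num.sqrt 2)); Some (row3 2 0 1);
                      Some (row3 1 1 1); None],
      good_grenier_domain (@Gamma R) G F &
      fundamental_domain (@H3 R) (@Gamma R) (@eq_pm R) (@mobius R) F].
Proof.
have GT := @triangleP R; move=> G F; split.
- by rewrite /F (grenier_triE GT); exact: solid_hull.
- split.
  + split; [exact: Gamma_A1 | exact: Gamma_A2 | exact: Gamma_A3 | exact: Gamma_A4].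
  + exact: fundamental_domain_C.
  + exact: closure_interior_tri.
  + by [].
- exact: fundamental_domain_H3.
Qed.
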